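(* The defining ideal $\ker\Psi_{\mathcal R}$ of the Rees ring $\mathcal{R}(I)$ is minimally generated by the following polynomials: (1) $\xi_{1,\alpha}Y_{\beta,\gamma}-\xi_{1,\beta}Y_{\alpha,\gamma}+\xi_{1,\gamma}Y_{\alpha,\beta}$ and $\xi_{2,\alpha}Y_{\beta,\gamma}-\xi_{2,\beta}Y_{\alpha,\gamma}+\xi_{2,\gamma}Y_{\alpha,\beta}$, for $(\alpha,\beta,\gamma)\in\binom{[c]}{3}$; (2) $Y_{\alpha,\beta}Y_{\gamma,\delta}-Y_{\alpha,\gamma}Y_{\beta,\delta}+Y_{\alpha,\delta}Y_{\beta,\gamma}$, for $(\alpha,\beta,\gamma,\delta)\in\binom{[c]}{4}$; (3) $Y_{\alpha,\beta}Y_{\gamma+1,\delta+1}-Y_{\alpha,\gamma}Y_{\beta+1,\delta+1}+Y_{\alpha,\delta}Y_{\beta+1,\gamma+1}+Y_{\beta,\gamma}Y_{\alpha+1,\delta+1}-Y_{\beta,\delta}Y_{\alpha+1,\gamma+1}+Y_{\gamma,\delta}Y_{\alpha+1,\beta+1}$, for $(\alpha,\beta,\gamma,\delta)\in\binom{\Gamma}{4}$, where $\Gamma=[c]\setminus\{n_1,\,n_1+n_2,\,\ldots,\,n_1+\cdots+n_d\}$. The defining ideal $\ker\Psi_{\mathcal F}$ of the special fiber ring $\mathbb{K}[\mathbf{f}]$ is minimally generated by the polynomials in (2) and (3). Moreover, there exist a term order on $R[Y_{\alpha,\beta}]$ and a term order on $\mathbb{K}[Y_{\alpha,\beta}]$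 with respect to which these generating sets of $\ker\Psi_{\mathcal R}$ and $\ker\Psi_{\mathcal F}$, respectively, are Gröbner bases.
   Context: Let $\mathbb{K}$ be an arbitrary field, $d\ge 1$, and $1\le n_1\le n_2\le\cdots\le n_d$ integers; put $c=\sum_{i=1}^d n_i$. Write $[n]=\{1,\ldots,n\}$, and for a set $\Gamma$ of integers let $\binom{\Gamma}{k}$ be the set of strictly increasing $k$-tuples of elements of $\Gamma$. Let $R=\mathbb{K}[x_{i,j}\mid 1\le i\le d,\ 0\le j\le n_i]$ be a polynomial ring. Let $\mathbf{X}$ be the $2\times c$ matrix obtained by juxtaposing, for $i=1,\ldots,d$ in this order, the $2\times n_i$ blocks $$\begin{pmatrix}x_{i,0}&x_{i,1}&\cdots&x_{i,n_i-1}\\ x_{i,1}&x_{i,2}&\cdots&x_{i,n_i}\end{pmatrix}.$$ Denote its entries by $\xi_{i,j}$, let $f_{\alpha,\beta}=\xi_{1,\alpha}\xi_{2,\beta}-\xi_{1,\beta}\xi_{2,\alpha}$ for $1\le\alpha<\beta\le c$, let $\mathbf{f}=\{f_{\alpha,\beta}\}$, and let $I=(\mathbf{f})\subseteq R$, which is the homogeneous ideal of the rational normal scroll $\mathcal{S}_{n_1,\ldots,n_d}\subseteq\mathbb{P}^{c+d-1}$. The Rees ring is $\mathcal{R}(I)=R[It]\subseteq R[t]$ with $t$ a new variable, and the special fiber ring is $\mathbb{K}[\mathbf{f}]\subseteq R$. Let $Y_{\alpha,\beta}$, $1\le\alpha<\beta\le c$, be new variables. Define the surjective $\mathbb{K}$-algebra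 homomorphisms $\Psi_{\mathcal R}:R[Y_{\alpha,\beta}]\to\mathcal{R}(I)$ by $Y_{\alpha,\beta}\mapsto t f_{\alpha,\beta}$, $x_{i,j}\mapsto x_{i,j}$, and $\Psi_{\mathcal F}:\mathbb{K}[Y_{\alpha,\beta}]\to\mathbb{K}[\mathbf{f}]$ by $Y_{\alpha,\beta}\mapsto f_{\alpha,\beta}$. *)

(* Defs.v *)
From HB Require Import structures.
From mathcomp Require Import all_boot all_order all_algebra.
From mathcomp Require Import mpoly.

Set Implicit Arguments.
Unset Strict Implicit.
Unset Printing Implicit Defensive.

Import GRing.Theory.
Local Open Scope ring_scope.

(** * Ideals and Groebner bases *)

Definition ideal_gen (R : comNzRingType) (S : R -> Prop) : R -> Prop :=
  fun p => exists s : seq (R * R),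
    (forall u, u \in s -> S u.2) /\ p = \sum_(u <- s) u.1 * u.2.

Definition family_image (T A : Type) (g : T -> A) : A -> Prop :=
  fun p => exists i, p = g i.

(* The family is irredundant: no member lies in the ideal generated by the
   others (in particular its members are pairwise distinct). *)
Definition minimally_generated_by (R : comNzRingType) (T : eqType)
    (J : R -> Prop) (g : T -> R) : Prop :=
  (forall p, J p <-> ideal_gen (family_image g) p) /\
  (forall i, ~ ideal_gen (fun p => exists2 j, j != i & p = g j) (g i)).

Definition ker (A B : nmodType) (phi : A -> B) : A -> Prop :=
  fun p => phi p = 0.

Inductive subring_gen (R : nzRingType) (S : R -> Prop) : R -> Prop :=
| subring_gen_in a : S a -> subring_gen S a
| subring_gen_1 : subring_gen S 1
| subring_gen_N a : subring_gen S a -> subring_gen S (- a)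
| subring_gen_D a b :
    subring_gen S a -> subring_gen S b -> subring_gen S (a + b)
| subring_gen_M a b :
    subring_gen S a -> subring_gen S b -> subring_gen S (a * b).

(* [le] is the non-strict (<=) version of the term order. *)
Definition term_order (N : nat) (le : rel 'X_{1..N}) : Prop :=
  [/\ total le, antisymmetric le, transitive le,
      (forall m, le 0%MM m) &
      (forall m m1 m2, le m1 m2 -> le (m1 + m)%MM (m2 + m)%MM)].

Definition is_leading_monomial (K : fieldType) (N : nat) (le : rel 'X_{1..N})
    (p : {mpoly K[N]}) (m : 'X_{1..N}) : Prop :=
  m \in msupp p /\ (forall m', m' \in msupp p -> le m' m).

(* The ideal generated by the leading monomials of the nonzero elements of
   [S]; the zero polynomial has no leading monomial. *)
Definition initial_ideal (K : fieldType) (N : nat) (le : rel 'X_{1..N})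
    (S : {mpoly K[N]} -> Prop) : {mpoly K[N]} -> Prop :=
  ideal_gen (fun q => exists p m,
    [/\ S p, is_leading_monomial le p m & q = 'X_[m]]).

Definition groebner_basis (K : fieldType) (N : nat) (le : rel 'X_{1..N})
    (T : Type) (J : {mpoly K[N]} -> Prop) (g : T -> {mpoly K[N]}) : Prop :=
  (forall i, J (g i)) /\
  (forall p, initial_ideal le J p <-> initial_ideal le (family_image g) p).

(** * Index sets.  The columns [c] = {1, ..., c} are numbered from 0, by 'I_c. *)

Definition increasing (c : nat) (G : {set 'I_c}) (k : nat) (t : k.-tuple 'I_c) :
    bool :=
  sorted (fun a b : 'I_c => (a < b)%N) t && all (mem G) t.

Definition incr (c : nat) (G : {set 'I_c}) (k : nat) : Type :=
  {t : k.-tuple 'I_c | increasing G t}.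
HB.instance Definition _ c (G : {set 'I_c}) k :=
  Finite.copy (incr G k) {t : k.-tuple 'I_c | increasing G t}.

Definition codim (d : nat) (n : 'I_d -> nat) : nat := \sum_i n i.

(* The column numbered [a] from 0 is the column [a.+1] in the numbering from 1;
   the excluded columns are the last columns of the blocks. *)
Definition Gam (d : nat) (n : 'I_d -> nat) : {set 'I_(codim n)} :=
  [set a : 'I_(codim n) |
    [forall i : 'I_d, a.+1 != \sum_(j < d | (j <= i)%N) n j]].

(** * Polynomial rings.  Variables indexed by a finite type [T] are numbered by
    [enum_rank]. *)

Definition mvar (K : fieldType) (T : finType) (v : T) : {mpoly K[#|T|]} :=
  'X_(enum_rank v).

(* [Tagged _ j : xvar n], with [j : 'I_(n i).+1], stands for x_{i,j}. *)
Definition xvar (d : nat) (n : 'I_d -> nat) : Type := {i : 'I_d & 'I_(n i).+1}.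
HB.instance Definition _ d (n : 'I_d -> nat) :=
  Finite.copy (xvar n) {i : 'I_d & 'I_(n i).+1}.

Definition yvar (d : nat) (n : 'I_d -> nat) : Type :=
  incr [set: 'I_(codim n)] 2.
HB.instance Definition _ d (n : 'I_d -> nat) :=
  Finite.copy (yvar n) (incr [set: 'I_(codim n)] 2).

Notation polyR K n := {mpoly K[#|{: xvar n}|]}.
Notation polyY K n := {mpoly K[#|{: yvar n}|]}.
(* R[Y] as a polynomial ring over K in the variables x and Y together. *)
Notation polyRY K n := {mpoly K[#|{: xvar n + yvar n}|]}.

(** * The scroll and its blowup algebras *)

(* The matrix X with the values [x] substituted for its variables, so that it
   can be taken in both R and R[Y]; entry (r, k) of the i-th block is
   x_{i, r + k}, for r = 0, 1. *)
Definition scroll_mx (A : nzRingType) (d : nat) (n : 'I_d -> nat)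
    (x : xvar n -> A) : 'M[A]_(2, codim n) :=
  \mxrow_(i < d) \matrix_(r < 2, k < n i)
    x (Tagged (fun i => 'I_(n i).+1) (inord (r + k) : 'I_(n i).+1)).

Definition minor2 (K : fieldType) (d : nat) (n : 'I_d -> nat) (t : yvar n) :
    polyR K n :=
  let X := scroll_mx (@mvar K (xvar n)) in
  let a := tnth (val t) 0 in
  let b := tnth (val t) 1 in
  X 0 a * X 1 b - X 0 b * X 1 a.

Definition scroll_ideal (K : fieldType) (d : nat) (n : 'I_d -> nat) :
    polyR K n -> Prop :=
  ideal_gen (family_image (@minor2 K d n)).

Definition psi_rees (K : fieldType) (d : nat) (n : 'I_d -> nat) :
    polyRY K n -> {poly polyR K n} :=
  mmap (polyC \o @mpolyC #|{: xvar n}| K)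
       (fun k => match enum_val k with
                 | inl v => (mvar K v)%:P
                 | inr t => minor2 K t *: 'X
                 end).

Definition psi_fiber (K : fieldType) (d : nat) (n : 'I_d -> nat) :
    polyY K n -> polyR K n :=
  mmap (@mpolyC #|{: xvar n}| K) (fun k => minor2 K (enum_val k)).

(* The Rees ring R[It] inside R[t], with t = 'X. *)
Definition rees_ring (K : fieldType) (d : nat) (n : 'I_d -> nat) :
    {poly polyR K n} -> Prop :=
  subring_gen (fun q => (exists r, q = r%:P) \/
                        (exists2 a, scroll_ideal a & q = a *: 'X)).

Definition special_fiber_ring (K : fieldType) (d : nat) (n : 'I_d -> nat) :
    polyR K n -> Prop :=
  subring_gen (fun q => (exists a : K, q = a%:MP) \/
                        family_image (@minor2 K d n) q).

(* The maps psi are surjective onto these rings, so that their kernels as maps to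
   R[t] and to R are the defining ideals of the two algebras. *)

Lemma psi_fiber_image (K : fieldType) (d : nat) (n : 'I_d -> nat)
    (q : polyR K n) :
  special_fiber_ring q <-> exists p, psi_fiber p = q.
Proof.
split.
  elim=> {q} [q [[a ->]|[t ->]]||a _ [p <-]|a b _ [p <-] _ [p' <-]|a b _ [p <-] _ [p' <-]].
  - by exists a%:MP; rewrite /psi_fiber mmapC.
  - by exists (mvar K t); rewrite /psi_fiber /mvar mmapX mmap1U enum_rankK.
  - by exists 1; rewrite /psi_fiber rmorph1.
  - by exists (- p); rewrite /psi_fiber rmorphN.
  - by exists (p + p'); rewrite /psi_fiber rmorphD.
  - by exists (p * p'); rewrite /psi_fiber rmorphM.
case=> p <-; elim/mpolyind: p => [|a m p _ _ IH].
  rewrite /psi_fiber mmap0; apply: subring_gen_in; left; exists 0; by rewrite mpolyC0.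
rewrite /psi_fiber mmapD mmapZ mmapX; apply: subring_gen_D IH.
apply: subring_gen_M; first by apply: subring_gen_in; left; exists a.
rewrite /mmap1; apply: (big_ind (fun x => special_fiber_ring x)).
- exact: subring_gen_1.
- by move=> x y; apply: subring_gen_M.
move=> i _; elim: (m i) => [|k IHk]; first by rewrite expr0; apply: subring_gen_1.
rewrite exprS; apply: subring_gen_M IHk.
by apply: subring_gen_in; right; exists (enum_val i).
Qed.

Lemma psi_rees_image (K : fieldType) (d : nat) (n : 'I_d -> nat)
    (q : {poly polyR K n}) :
  rees_ring q <-> exists p, psi_rees p = q.
Proof.
pose T : finType := (xvar n + yvar n)%type.
have PX (v : T) : psi_rees ('X_(enum_rank v) : polyRY K n) =
   match v with inl v => (mvar K v)%:P | inr t => minor2 K t *: 'X end.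
  by rewrite /psi_rees mmapX mmap1U enum_rankK.
have imC (r : polyR K n) : exists p : polyRY K n, psi_rees p = r%:P.
  exists (mmap (@mpolyC #|T| K) (fun k => mvar K (inl (enum_val k) : T)) r).
  elim/mpolyind: r => [|a m r _ _ IH]; first by rewrite mmap0 /psi_rees mmap0 polyC0.
  rewrite mmapD mmapZ mmapX polyCD {1}/psi_rees rmorphD rmorphM /= -!/(psi_rees _) IH.
  congr (_ + _); rewrite {1}/psi_rees mmapC -mul_mpolyC polyCM; congr (_ * _).
  rewrite /mmap1 mpolyXE_id /psi_rees !rmorph_prod /=; apply: eq_bigr => i _.
  by rewrite !rmorphXn /= -/(psi_rees _) PX /mvar enum_valK.
split.
  elim=> {q} [q [[r ->]|[a [s [sP ->]] ->]]||a _ [p <-]|a b _ [p <-] _ [p' <-]|a b _ [p <-] _ [p' <-]].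
  - exact: imC.
  - elim: s sP => [|u s IH] sP.
      by exists 0; rewrite big_nil scale0r /psi_rees mmap0.
    have [//|p Hp] := IH; first by move=> v vs; apply: sP; rewrite inE vs orbT.
    have [p1 Hp1] := imC u.1.
    have [t Ht] := sP u (mem_head _ _).
    exists (p1 * 'X_(enum_rank (inr t : T)) + p).
    rewrite {1}/psi_rees mmapD rmorphM /= -!/(psi_rees _) Hp Hp1 PX.
    rewrite big_cons Ht [RHS]scalerDl; congr (_ + _).
    by rewrite -[RHS]scalerA mul_polyC.
  - by exists 1; rewrite /psi_rees rmorph1.
  - by exists (- p); rewrite /psi_rees rmorphN.
  - by exists (p + p'); rewrite /psi_rees rmorphD.
  - by exists (p * p'); rewrite /psi_rees rmorphM.
case=> p <-; elim/mpolyind: p => [|a m p _ _ IH].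
  by rewrite /psi_rees mmap0; apply: subring_gen_in; left; exists 0; rewrite polyC0.
rewrite /psi_rees mmapD mmapZ mmapX; apply: subring_gen_D IH.
apply: subring_gen_M; first by apply: subring_gen_in; left; exists a%:MP.
rewrite /mmap1; apply: (big_ind (fun x => rees_ring x)).
- exact: subring_gen_1.
- by move=> x y; apply: subring_gen_M.
move=> i _; elim: (m i) => [|k IHk]; first by rewrite expr0; apply: subring_gen_1.
rewrite exprS; apply: subring_gen_M IHk; apply: subring_gen_in.
case: (enum_val i) => [v|t]; [by left; exists (mvar K v)|right].
exists (minor2 K t) => //; exists [:: (1, minor2 K t)]; split.
  by move=> u; rewrite inE => /eqP ->; exists t.
by rewrite big_seq1 mul1r.
Qed.

(** * The generators *)

(* Y_{a,b}, read as 0 unless a < b. *)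
Definition ycoord (A : nzRingType) (d : nat) (n : 'I_d -> nat)
    (y : yvar n -> A) (a b : 'I_(codim n)) : A :=
  oapp y 0 (insub [tuple a; b] : option (yvar n)).

Definition linear_rel (A : nzRingType) (d : nat) (n : 'I_d -> nat)
    (x : xvar n -> A) (y : yvar n -> A)
    (r : 'I_2) (t : incr [set: 'I_(codim n)] 3) : A :=
  let X := scroll_mx x in
  let Y := ycoord y in
  let a := tnth (val t) 0 in
  let b := tnth (val t) 1 in
  let c := tnth (val t) 2 in
  X r a * Y b c - X r b * Y a c + X r c * Y a b.

Definition plucker_rel (A : nzRingType) (d : nat) (n : 'I_d -> nat)
    (y : yvar n -> A) (t : incr [set: 'I_(codim n)] 4) : A :=
  let Y := ycoord y in
  let a := tnth (val t) 0 in
  let b := tnth (val t) 1 in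
  let c := tnth (val t) 2 in
  let e := tnth (val t) 3 in
  Y a b * Y c e - Y a c * Y b e + Y a e * Y b c.

(* [ordS] is the cyclic successor; it is the ordinary one on [Gam n], which
   does not contain the last column. *)
Definition shifted_rel (A : nzRingType) (d : nat) (n : 'I_d -> nat)
    (y : yvar n -> A) (t : incr (Gam n) 4) : A :=
  let Y := ycoord y in
  let a := tnth (val t) 0 in
  let b := tnth (val t) 1 in
  let c := tnth (val t) 2 in
  let e := tnth (val t) 3 in
  Y a b * Y (ordS c) (ordS e) - Y a c * Y (ordS b) (ordS e)
  + Y a e * Y (ordS b) (ordS c) + Y b c * Y (ordS a) (ordS e)
  - Y b e * Y (ordS a) (ordS c) + Y c e * Y (ordS a) (ordS b).

Definition fiber_index (d : nat) (n : 'I_d -> nat) : Type :=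
  (incr [set: 'I_(codim n)] 4 + incr (Gam n) 4)%type.
HB.instance Definition _ d (n : 'I_d -> nat) :=
  Finite.copy (fiber_index n)
    (incr [set: 'I_(codim n)] 4 + incr (Gam n) 4)%type.

Definition quadric_rel (A : nzRingType) (d : nat) (n : 'I_d -> nat)
    (y : yvar n -> A) (k : fiber_index n) : A :=
  match k with
  | inl t => plucker_rel y t
  | inr t => shifted_rel y t
  end.

Definition fiber_gens (K : fieldType) (d : nat) (n : 'I_d -> nat) :
    fiber_index n -> polyY K n :=
  quadric_rel (@mvar K (yvar n)).

Definition rees_index (d : nat) (n : 'I_d -> nat) : Type :=
  ('I_2 * incr [set: 'I_(codim n)] 3 + fiber_index n)%type.
HB.instance Definition _ d (n : 'I_d -> nat) :=
  Finite.copy (rees_index n)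
    ('I_2 * incr [set: 'I_(codim n)] 3 + fiber_index n)%type.

Definition rees_gens (K : fieldType) (d : nat) (n : 'I_d -> nat)
    (k : rees_index n) : polyRY K n :=
  let x (v : xvar n) := mvar K (inl v : xvar n + yvar n) in
  let y (t : yvar n) := mvar K (inr t : xvar n + yvar n) in
  match k with
  | inl (r, t) => linear_rel x y r t
  | inr l => quadric_rel y l
  end.

(* Main.v *)
Require Import Defs.
From HB Require Import structures.
From mathcomp Require Import all_boot all_order all_algebra.
From mathcomp Require Import mpoly zify ring.

(** Write xi1 a and xi2 a for the two entries of the column a.  The plan is the
    method of standard monomials.  If polynomials g_i of an ideal J have leading
    monomials l_i, and no nonzero element of J is supported on monomials
    divisible by no l_i, then division by the g_i shows that they form a
    Groebner basis and generate J ([ideal_gen_kernel], [kernel_groebner]); if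
    moreover the g_i have one common degree and distinct leading monomials, none
    of them is redundant ([distinct_leads_irredundant]).  It remains to choose a
    term order and to show that the images of the standard monomials are
    linearly independent.

    The order.  The columns are totally ordered by a number [delta], the last
    columns of the blocks coming after all the others, and [wt] is the weight of
    the variables x with wt (xi2 a) = wt (xi1 a) + delta a.  Give Y_{a,b} the
    weight wt (xi1 a) + wt (xi1 b).  Then the leading term of a second-row linear
    relation is xi2 c Y_{a,b} with delta c maximal, and that of a shifted
    relation is the product in which the shifted pair of columns is the one with
    the two largest values of [delta].  The Pluecker relations and the first-row
    linear relations are homogeneous for this weight.  For them, put the columns
    on a circle by means of [pos], read Y_{a,b} as the chord from a to b and
    xi1 a as the chord from an additional point 0 to a; weighting a chord by the
    product of the two arcs that it cuts off makes the crossing pair of chords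
    the leading term ([chord_separates]).  The standard monomials are therefore
    noncrossing graphs with legs that satisfy two further conditions on [delta]
    ([admissible]).

    Independence.  The two terms of a minor, xi1 a xi2 b and xi1 b xi2 a, have
    weights that differ by delta b - delta a.  Fix a column i, the threshold, and
    replace every delta a by the minimum of delta a and delta i in the
    weight of xi2 a ([cut]).  For an admissible monomial the threshold can be
    chosen so that the image of each of its variables attains the largest weight
    that the cut-off allows ([admissible_valid]).  The leading term of each minor,
    for this weight and a suitable tie-break, then orients the edge from the end
    of smaller [rank] to the end of larger [rank], the first being taken in the
    first row and the second in the second row.  The leading monomial of the image so determines
    the outdegrees and the indegrees of an oriented noncrossing graph.  As [rank]
    is unimodal along [pos], the degrees determine the graph
    ([noncrossing_inj]).  In a linear relation between images, consider the
    monomials of maximal weight and the threshold of one of them: the largest of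
    their leading monomials cannot cancel ([admissible_free]).

    The special fiber is handled with the same leading terms: a relation between
    the images of monomials in the Y splits into its homogeneous components
    ([psi_fiber_component]). *)

Set Implicit Arguments.
Unset Strict Implicit.
Unset Printing Implicit Defensive.

Import GRing.Theory.
Local Open Scope ring_scope.

(** * Ideals generated by polynomials with known leading monomials *)

Section IdealGen.
Variable R : comNzRingType.
Implicit Types (S : R -> Prop) (p q : R).

Lemma ideal_gen0 S : ideal_gen S 0.
Proof. by exists [::]; rewrite big_nil. Qed.

Lemma ideal_genD S p q : ideal_gen S p -> ideal_gen S q -> ideal_gen S (p + q).
Proof.
move=> [s [sS ->]] [s' [sS' ->]]; exists (s ++ s'); split; last by rewrite big_cat.
by move=> u; rewrite mem_cat => /orP[/sS|/sS'].
Qed.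

Lemma ideal_genM S r p : ideal_gen S p -> ideal_gen S (r * p).
Proof.
move=> [s [sS ->]]; exists [seq (r * u.1, u.2) | u <- s]; split.
  by move=> v /mapP[u us ->] /=; apply: sS us.
by rewrite big_map mulr_sumr; apply: eq_bigr => u _; rewrite mulrA.
Qed.

Lemma ideal_gen_in S p : S p -> ideal_gen S p.
Proof.
move=> Sp; exists [:: (1, p)]; split; last by rewrite big_seq1 mul1r.
by move=> u; rewrite inE => /eqP ->.
Qed.

Lemma ideal_gen_min S (J : R -> Prop) :
    J 0 -> (forall p q, J p -> J q -> J (p + q)) -> (forall r p, J p -> J (r * p)) ->
  (forall p, S p -> J p) -> forall p, ideal_gen S p -> J p.
Proof.
move=> J0 JD JM SJ _ [s [sS ->]].
elim: s sS => [|u s IH] sS; first by rewrite big_nil.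
rewrite big_cons; apply: JD; first by apply/JM/SJ/sS/mem_head.
by apply: IH => v vs; apply: sS; rewrite inE vs orbT.
Qed.

Lemma ideal_gen_sub S S' :
  (forall p, S p -> ideal_gen S' p) -> forall p, ideal_gen S p -> ideal_gen S' p.
Proof.
move=> SS'; apply: ideal_gen_min SS'.
- exact: ideal_gen0.
- exact: ideal_genD.
- exact: ideal_genM.
Qed.

End IdealGen.

Section StandardMonomials.
Variables (K : fieldType) (N : nat) (le : rel 'X_{1..N}).
Hypothesis le_ord : term_order le.
Hypothesis le_wf : well_founded (fun m m' => le m m' && (m != m')).
Variables (T : finType) (g : T -> {mpoly K[N]}) (l : T -> 'X_{1..N}).
Hypothesis lead_g : forall i, is_leading_monomial le (g i) (l i).

Definition standard (m : 'X_{1..N}) : Prop := forall i, ~~ (l i <= m)%MM.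

Lemma term_order_refl m : le m m.
Proof. by case: le_ord => tot _ _ _ _; have /orP[] := tot m m. Qed.

Lemma term_order_trans m1 m2 m3 : le m1 m2 -> le m2 m3 -> le m1 m3.
Proof. by case: le_ord => _ _ tr _ _; apply: tr. Qed.

Lemma term_order_anti m1 m2 : le m1 m2 -> le m2 m1 -> m1 = m2.
Proof. by case: le_ord => _ an _ _ _ h1 h2; apply: an; rewrite h1. Qed.

Lemma term_order_add m m1 m2 : le m1 m2 -> le (m1 + m)%MM (m2 + m)%MM.
Proof. by case: le_ord => _ _ _ _ ad; apply: ad. Qed.

Definition reduces_below (B : 'X_{1..N} -> Prop) (p : {mpoly K[N]}) : Prop :=
  exists q r, [/\ p = q + r, ideal_gen (family_image g) q &
    forall m, m \in msupp r -> standard m /\ B m].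

Lemma reduces_below0 B : reduces_below B 0.
Proof.
by exists 0, 0; rewrite addr0; split=> //; [apply: ideal_gen0 | move=> m; rewrite msupp0].
Qed.

Lemma reduces_belowDZ B c p p' :
  reduces_below B p -> reduces_below B p' -> reduces_below B (c *: p + p').
Proof.
move=> [q [r [-> Iq rB]]] [q' [r' [-> Iq' rB']]].
exists (c *: q + q'), (c *: r + r'); split.
- by rewrite scalerDr addrACA.
- by apply: ideal_genD => //; rewrite -mul_mpolyC; apply: ideal_genM.
move=> m /msuppD_le; rewrite mem_cat => /orP[/msuppZ_le|]; [exact: rB | exact: rB'].
Qed.

Lemma reduces_below_sum B (I : eqType) (s : seq I) (a : I -> K) (f : I -> 'X_{1..N}) :
    (forall m, m \in s -> reduces_below B 'X_[f m]) ->
  reduces_below B (\sum_(m <- s) a m *: 'X_[f m]).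
Proof.
elim: s => [|m s IH] sB; first by rewrite big_nil; apply: reduces_below0.
rewrite big_cons; apply: reduces_belowDZ; first by apply: sB; apply: mem_head.
by apply: IH => m' m's; apply: sB; rewrite inE m's orbT.
Qed.

Lemma reduces_below_sub (B B' : 'X_{1..N} -> Prop) p :
  (forall m, B m -> B' m) -> reduces_below B p -> reduces_below B' p.
Proof.
by move=> BB' [q [r [-> Iq rB]]]; exists q, r; split=> // m /rB[? /BB'].
Qed.

(** Division by [g]: a non-standard monomial is a multiple of the leading
    monomial of some [g i], and subtracting the corresponding multiple of [g i]
    leaves smaller monomials only. *)
Lemma monomial_reduces m : reduces_below (fun m' => le m' m) 'X_[m].
Proof.
elim/(well_founded_induction le_wf): m => m IH.
have [/existsP[i lim] | nex] := boolP [exists i, (l i <= m)%MM]; last first.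
  exists 0, 'X_[m]; split; [by rewrite add0r | exact: ideal_gen0 |].
  move=> m'; rewrite msuppX inE => /eqP ->; split; last exact: term_order_refl.
  by move=> i; apply: contra nex => lim; apply/existsP; exists i.
have [lsupp lmax] := lead_g i.
set c := (g i)@_(l i); have c0 : c != 0 by rewrite -mcoeff_msupp.
set k := (m - l i)%MM; have mE : m = (l i + k)%MM by rewrite addmC submK.
have -> : 'X_[m] = c^-1 *: ('X_[k] * g i) +
    (\sum_(m' <- [seq m' <- msupp (g i) | m' != l i])
      (- (c^-1 * (g i)@_m')) *: 'X_[(m' + k)%MM] + 0) :> {mpoly K[N]}.
  rewrite addr0 big_filter {1}[g i]mpolyE (bigD1_seq (l i)) ?msupp_uniq //=.
  rewrite mulrDr scalerDr -scalerAr scalerA mulVf // scale1r -mpolyXD addmC -mE.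
  rewrite -addrA -[LHS]addr0; congr (_ + _).
  rewrite mulr_sumr scaler_sumr -big_split /= big1 // => m' _.
  by rewrite -scalerAr scalerA -mpolyXD addmC scaleNr subrr.
apply: reduces_belowDZ.
  exists ('X_[k] * g i), 0; split; first by rewrite addr0.
    by apply/ideal_genM/ideal_gen_in; exists i.
  by move=> m'; rewrite msupp0.
rewrite addr0; apply: reduces_below_sum => m'.
rewrite mem_filter => /andP[ne m's].
have lt : le (m' + k)%MM m && ((m' + k)%MM != m).
  rewrite mE term_order_add ?lmax //=; apply: contra ne => /eqP e.
  by apply/eqP; apply: (@addIm _ k).
apply: reduces_below_sub (IH _ lt) => m'' /term_order_trans; apply.
by case/andP: lt.
Qed.

Lemma poly_reduces p :
  reduces_below (fun m => exists2 m', m' \in msupp p & le m m') p.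
Proof.
rewrite {2}[p]mpolyE; apply: reduces_below_sum => m mp.
by apply: reduces_below_sub (monomial_reduces m) => m' lem; exists m.
Qed.

Variable J : {mpoly K[N]} -> Prop.
Hypotheses (J0 : J 0) (JD : forall p q, J p -> J q -> J (p + q))
  (JM : forall r p, J p -> J (r * p)) (Jg : forall i, J (g i))
  (Jindep : forall p, J p -> (forall m, m \in msupp p -> standard m) -> p = 0).

(** The remainder of an element of [J] lies in [J] and is supported on
    standard monomials, so it vanishes. *)
Lemma ideal_gen_kernel p : ideal_gen (family_image g) p <-> J p.
Proof.
split; first by apply: ideal_gen_min => // _ [i ->]; apply: Jg.
move=> Jp; have [q [r [pE Iq rstd]]] := poly_reduces p.
have Jq : J q by apply: ideal_gen_min Iq => // _ [i ->]; apply: Jg.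
suff r0 : r = 0 by rewrite pE r0 addr0.
apply: Jindep => [|m /rstd[] //].
have -> : r = p + (-1) * q by rewrite pE mulN1r addrAC subrr add0r.
by apply: JD => //; apply: JM.
Qed.

(** If the leading monomial [m] were standard, dividing only the other terms
    would keep the coefficient of [m], because the monomials that appear are
    smaller than [m]; but the remainder is zero. *)
Lemma leading_monomial_divisible p m :
  J p -> is_leading_monomial le p m -> exists i, (l i <= m)%MM.
Proof.
move=> Jp [mp mmax].
have [/existsP // | nex] := boolP [exists i, (l i <= m)%MM].
have std : standard m by move=> i; apply: contra nex => lim; apply/existsP; exists i.
set p' := p - p@_m *: 'X_[m].
have [q [r [pE Iq rB]]] := poly_reduces p'.
have supp' m' : m' \in msupp p' -> m' != m /\ m' \in msupp p.
  rewrite !mcoeff_msupp /p' mcoeffB mcoeffZ mcoeffX => h.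
  have ne : m' != m.
    by apply: contra h => /eqP->; rewrite eqxx mulr1 subrr.
  by split=> //; move: h; rewrite [m == m']eq_sym (negbTE ne) mulr0 subr0.
have rm : r@_m = 0.
  apply/memN_msupp_eq0/negP => /rB[_ [m' /supp'[ne /mmax le1] le2]].
  by case/eqP: ne; apply: term_order_anti.
have Jq : J q by apply/ideal_gen_kernel.
have : p@_m *: 'X_[m] + r = 0.
  apply: Jindep.
    suff -> : p@_m *: 'X_[m] + r = p + (-1) * q by apply: JD => //; apply: JM.
    by have -> : r = p' - q by [rewrite pE addrC addKr]; rewrite mulN1r addrA subrKC.
  move=> m' /msuppD_le; rewrite mem_cat => /orP[/msuppZ_le|/rB[]//].
  by rewrite msuppX inE => /eqP ->.
move/(congr1 (mcoeff m)); rewrite mcoeffD mcoeffZ mcoeffX eqxx mulr1 rm addr0 mcoeff0.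
by move/eqP; rewrite mcoeff_eq0 mp.
Qed.

Lemma kernel_groebner : groebner_basis le J g.
Proof.
split=> // p; split; apply: ideal_gen_sub => {p} _ [p [m [Sp mlead ->]]].
  have [i lim] := leading_monomial_divisible Sp mlead.
  rewrite -(submK lim) mpolyXD; apply/ideal_genM/ideal_gen_in.
  by exists (g i), (l i); split=> //; exists i.
apply: ideal_gen_in; exists p, m; split=> //.
by case: Sp => i ->.
Qed.
End StandardMonomials.

(** If [b] is homogeneous of degree [mdeg m], only the constant term of [a]
    contributes to the coefficient of [m]. *)
Lemma mcoeffM_homog (K : fieldType) (N : nat) (a b : {mpoly K[N]}) m :
    (forall k, k \in msupp b -> mdeg k = mdeg m) ->
  (a * b)@_m = a@_0%MM * b@_m.
Proof.
move=> bm; rewrite {1}[b]mpolyE mulr_sumr raddf_sum /=.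
have E k : k \in msupp b -> (a * (b@_k *: 'X_[k]))@_m = (k == m)%:R * (a@_0%MM * b@_m).
  move=> kb; rewrite -scalerAr mcoeffZ; have [->|ne] := eqVneq k m.
    by have := mcoeffMX a m 0; rewrite addm0 => ->; rewrite mul1r mulrC.
  rewrite mul0r (_ : (a * 'X_[k])@_m = 0) ?mulr0 //.
  apply/memN_msupp_eq0; rewrite (perm_mem (msuppMX a k)).
  apply/mapP => -[k' _ mE]; case/eqP: ne.
  have := bm _ kb; rewrite mE mdegD => /eqP; rewrite -{1}[mdeg k]addn0 eqn_add2l eq_sym mdeg_eq0.
  by move/eqP ->; rewrite addm0.
rewrite big_seq_cond (eq_bigr (fun k => (k == m)%:R * (a@_0%MM * b@_m))); last first.
  by move=> k /andP[/E].
rewrite -big_seq_cond; have [mb|/memN_msupp_eq0 mb] := boolP (m \in msupp b).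
  rewrite (bigD1_seq m) ?msupp_uniq //= eqxx mul1r big1 ?addr0 // => k /negbTE->.
  by rewrite mul0r.
by rewrite mb mulr0 big1 // => k _; rewrite mulr0.
Qed.

Section Irredundant.
Variables (K : fieldType) (N : nat) (le : rel 'X_{1..N}).
Hypothesis le_ord : term_order le.
Variables (T : finType) (g : T -> {mpoly K[N]}) (l : T -> 'X_{1..N}) (D : nat).
Hypothesis lead_g : forall i, is_leading_monomial le (g i) (l i).
Hypothesis homog_g : forall i m, m \in msupp (g i) -> mdeg m = D.
Hypothesis l_inj : injective l.

(** In degree [D] only the constant terms of the coefficients matter, so a
    redundancy is a linear relation; its largest leading monomial, which
    belongs to a single [g j], cannot cancel. *)
Lemma distinct_leads_irredundant i :
  ~ ideal_gen (fun p => exists2 j, j != i & p = g j) (g i).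
Proof.
move=> [s [sS giE]].
pose idx (u : {mpoly K[N]} * {mpoly K[N]}) : T := odflt i [pick j | (j != i) && (u.2 == g j)].
have idxP u : u \in s -> idx u != i /\ u.2 = g (idx u).
  move=> /sS [j ji uE]; rewrite /idx; case: pickP => [j' /andP[? /eqP]//|/(_ j)].
  by rewrite ji uE eqxx.
pose a j := if j == i then -1 else \sum_(u <- s | idx u == j) u.1@_0%MM.
have rel m : mdeg m = D -> \sum_j a j * (g j)@_m = 0.
  move=> mD; rewrite (bigD1 i) //= /a eqxx mulN1r.
  have -> : (g i)@_m = \sum_(u <- s) u.1@_0%MM * (g (idx u))@_m.
    rewrite giE raddf_sum /= big_seq [RHS]big_seq; apply: eq_bigr => u us.
    have [_ uE] := idxP u us; rewrite uE mcoeffM_homog // => k /homog_g ->.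
    by rewrite mD.
  have -> : \sum_(u <- s) u.1@_0%MM * (g (idx u))@_m
      = \sum_(u <- s | idx u != i) u.1@_0%MM * (g (idx u))@_m.
    rewrite big_seq [RHS]big_seq_cond; apply: eq_bigl => u.
    by case us: (u \in s) => //=; have [-> _] := idxP u us.
  rewrite (partition_big idx (fun j => j != i)) //= addrC.
  apply/eqP; rewrite subr_eq0; apply/eqP/eq_bigr => j ji.
  rewrite (negbTE ji) mulr_suml; apply: eq_big => [u|u /eqP -> //].
  by case: eqP => [->|_]; rewrite ?ji ?andbF.
pose P := [pred j | a j != 0].
have Pi : P i by rewrite /P /= /a eqxx oppr_eq0 oner_neq0.
have [tot anti trans _ _] := le_ord.
have rfl : reflexive le by move=> m; have /orP[] := tot m m.
have [j0 Pj0 jmax] : exists2 j0, P j0 & forall j, P j -> le (l j) (l j0).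
  pose ge m m' := le m' m.
  have := @extremumP _ _ ge i P l rfl (fun y x z h1 h2 => trans y z x h2 h1) (fun x y => tot y x) Pi.
  by case=> j Pj jm; exists j.
have [lsupp _] := lead_g j0.
have := rel (l j0) (homog_g lsupp).
rewrite (bigD1 j0) //= big1 ?addr0 => [/eqP|j jj0].
  by rewrite mulf_eq0 (negbTE Pj0) /= mcoeff_eq0 lsupp.
have [->|aj] := eqVneq (a j) 0; first by rewrite mul0r.
rewrite [X in _ * X](_ : _ = 0) ?mulr0 //; apply/eqP; rewrite mcoeff_eq0.
apply: contra jj0 => lj; apply/eqP/l_inj/anti; rewrite jmax //=.
by have [_] := lead_g j; apply.
Qed.
End Irredundant.

(** * Term orders defined by weights *)

Section Weights.
Variable N : nat.
Implicit Types (u : 'I_N -> nat) (m : 'X_{1..N}).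

Definition mwt u m : nat := (\sum_i m i * u i)%N.

Lemma mwt0 u : mwt u 0%MM = 0%N.
Proof. by rewrite /mwt big1 // => i _; rewrite mnm0E. Qed.

Lemma mwtD u m1 m2 : mwt u (m1 + m2)%MM = (mwt u m1 + mwt u m2)%N.
Proof. by rewrite /mwt -big_split; apply: eq_bigr => i _; rewrite mnmDE mulnDl. Qed.

Lemma mwtU u i : mwt u U_(i)%MM = u i.
Proof.
rewrite /mwt (bigD1 i) //= mnm1E eqxx mul1n big1 ?addn0 // => j ji.
by rewrite mnm1E eq_sym (negbTE ji).
Qed.

Lemma mwtMn u m k : mwt u (m *+ k)%MM = (k * mwt u m)%N.
Proof. by rewrite /mwt big_distrr; apply: eq_bigr => i _; rewrite mulmnE mulnAC mulnC. Qed.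

Lemma mwt_sum u (I : Type) (r : seq I) (F : I -> 'X_{1..N}) :
  mwt u (\sum_(i <- r) F i)%MM = (\sum_(i <- r) mwt u (F i))%N.
Proof. by apply: (big_morph (mwt u) (@mwtD u) (mwt0 u)). Qed.

Variable (K : fieldType).
Implicit Types (p q : {mpoly K[N]}).

Definition wt_le u b p := forall m, m \in msupp p -> (mwt u m <= b)%N.
Definition wt_lt u b p := forall m, m \in msupp p -> (mwt u m < b)%N.

Lemma wt_le1 u : wt_le u 0 1.
Proof. by move=> m; rewrite msupp1 inE => /eqP ->; rewrite mwt0. Qed.

Lemma wt_leM u b b' p q : wt_le u b p -> wt_le u b' q -> wt_le u (b + b')%N (p * q).
Proof.
by move=> hp hq m /msuppM_le/allpairsP[[m1 m2] /= [/hp h1 /hq h2 ->]]; rewrite mwtD; lia.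
Qed.

Lemma wt_ltM u b b' p q : wt_lt u b p -> wt_le u b' q -> wt_lt u (b + b')%N (p * q).
Proof.
by move=> hp hq m /msuppM_le/allpairsP[[m1 m2] /= [/hp h1 /hq h2 ->]]; rewrite mwtD; lia.
Qed.

Lemma wt_leX u b p k : wt_le u b p -> wt_le u (k * b)%N (p ^+ k).
Proof.
move=> hp; elim: k => [|k IH]; first by rewrite expr0; apply: wt_le1.
by rewrite exprS mulSn; apply: wt_leM.
Qed.

Lemma wt_le_prod u (I : Type) (r : seq I) (b : I -> nat) (F : I -> {mpoly K[N]}) :
  (forall i, wt_le u (b i) (F i)) -> wt_le u (\sum_(i <- r) b i)%N (\prod_(i <- r) F i).
Proof.
move=> hF; elim: r => [|i r IH]; first by rewrite !big_nil; apply: wt_le1.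
by rewrite !big_cons; apply: wt_leM.
Qed.

Definition wt_below u h m m' :=
  (mwt u m < mwt u m')%N || (mwt u m == mwt u m') && (mwt h m < mwt h m')%N.

(** [c X^mu] is the leading term of [p] for the weight [u], ties being broken
    by the weight [h]. *)
Definition wt_lead u h mu p : Prop :=
  exists c r, [/\ c != 0, p = c *: 'X_[mu] + r &
    forall m, m \in msupp r -> wt_below u h m mu].

Lemma wt_lead1 u h : wt_lead u h 0%MM 1.
Proof.
exists 1, 0; rewrite oner_neq0 scale1r addr0 mpolyX0.
by split=> // m; rewrite msupp0.
Qed.

Lemma wt_leadM u h mu nu p q :
  wt_lead u h mu p -> wt_lead u h nu q -> wt_lead u h (mu + nu)%MM (p * q).
Proof.
move=> [c [r [c0 -> hr]]] [c' [r' [c0' -> hr']]].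
exists (c * c'), (c *: 'X_[mu] * r' + r * (c' *: 'X_[nu] + r')); split.
- by rewrite mulf_neq0.
- by rewrite mulrDl !mulrDr -!addrA -scalerAl -scalerAr scalerA -mpolyXD.
have ltD m m' k : wt_below u h m m' -> wt_below u h (k + m)%MM (k + m')%MM.
  by rewrite /wt_below !mwtD; lia.
have ltD2 m m' k k' : wt_below u h m m' -> wt_below u h k k' -> wt_below u h (m + k)%MM (m' + k')%MM.
  by rewrite /wt_below !mwtD; lia.
move=> m /msuppD_le; rewrite mem_cat => /orP[] /msuppM_le/allpairsP[[m1 m2] /= [h1 h2 ->]].
  by move: h1 => /msuppZ_le; rewrite msuppX inE => /eqP ->; apply/ltD/hr'.
move: h2 => /msuppD_le; rewrite mem_cat => /orP[/msuppZ_le|/hr' h2]; last by apply: ltD2 => //; apply: hr.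
by rewrite msuppX inE => /eqP ->; rewrite addmC [(mu + nu)%MM]addmC; apply/ltD/hr.
Qed.

Lemma wt_leadX u h mu p k : wt_lead u h mu p -> wt_lead u h (mu *+ k)%MM (p ^+ k).
Proof.
move=> hp; elim: k => [|k IH]; first by rewrite expr0 mulm0n; apply: wt_lead1.
by rewrite exprS mulmS; apply: wt_leadM.
Qed.

Lemma wt_lead_prod u h (I : Type) (r : seq I) (mu : I -> 'X_{1..N}) (F : I -> {mpoly K[N]}) :
    (forall i, wt_lead u h (mu i) (F i)) ->
  wt_lead u h (\sum_(i <- r) mu i)%MM (\prod_(i <- r) F i).
Proof.
move=> hF; elim: r => [|i r IH]; first by rewrite !big_nil; apply: wt_lead1.
by rewrite !big_cons; apply: wt_leadM.
Qed.

Lemma wt_below_irr u h m : wt_below u h m m = false.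
Proof. by rewrite /wt_below; lia. Qed.

Lemma wt_lead_coeff u h mu p : wt_lead u h mu p -> p@_mu != 0.
Proof.
move=> [c [r [c0 -> hr]]]; rewrite mcoeffD mcoeffZ mcoeffX eqxx mulr1.
rewrite (_ : r@_mu = 0) ?addr0 //; apply/memN_msupp_eq0/negP => /hr.
by rewrite wt_below_irr.
Qed.

Lemma wt_lead_supp u h mu p m : wt_lead u h mu p -> m \in msupp p -> m = mu \/ wt_below u h m mu.
Proof.
move=> [c [r [c0 -> hr]]] /msuppD_le; rewrite mem_cat => /orP[/msuppZ_le|/hr]; last by right.
by rewrite msuppX inE => /eqP; left.
Qed.

End Weights.

Section WtLeadSum.
Variables (K : fieldType) (N : nat) (u h : 'I_N -> nat).
Implicit Types (mu m : 'X_{1..N}) (p r : {mpoly K[N]}).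

Lemma wt_leadU mu c : c != 0 -> wt_lead u h mu (c *: 'X_[mu] : {mpoly K[N]}).
Proof. by move=> c0; exists c, 0; split=> // [|m]; rewrite ?addr0 // msupp0. Qed.

Lemma wt_leadDl mu p c m : wt_lead u h mu p -> wt_below u h m mu -> wt_lead u h mu (p + c *: 'X_[m]).
Proof.
move=> [c0 [r [c00 -> hr]]] lt; exists c0, (r + c *: 'X_[m]); split=> //; first by rewrite addrA.
move=> m' /msuppD_le; rewrite mem_cat => /orP[/hr//|/msuppZ_le].
by rewrite msuppX inE => /eqP ->.
Qed.

Lemma wt_below_u m mu : (mwt u m < mwt u mu)%N -> wt_below u h m mu.
Proof. by rewrite /wt_below => ->. Qed.

Lemma wt_below_h m mu : mwt u m = mwt u mu -> (mwt h m < mwt h mu)%N -> wt_below u h m mu.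
Proof. by rewrite /wt_below => -> ->; rewrite eqxx orbT. Qed.

Lemma mnmU2_inj (i j k l : 'I_N) : (U_(i) + U_(j) = U_(k) + U_(l))%MM ->
  (i = k /\ j = l) \/ (i = l /\ j = k).
Proof.
move=> e; have := congr1 (fun m : 'X_{1..N} => m i) e; rewrite !mnmDE !mnm1E eqxx.
have [ki _|nk] := eqVneq k i.
  left; split=> //; move: e; rewrite ki => /(@addmI N) e.
  by apply/eqP; rewrite -(@eq_mnm1 N) e.
have [li _|//] := eqVneq l i.
right; split=> //; move: e; rewrite li addmC => /(@addIm N) e.
by apply/eqP; rewrite -(@eq_mnm1 N) e.
Qed.
End WtLeadSum.

Section WeightOrders.
Variable N : nat.
Implicit Types (le : rel 'X_{1..N}) (m : 'X_{1..N}) (u h : 'I_N -> nat).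

Definition strict le m m' := le m m' && (m != m').

Lemma multinom_term_order : term_order (fun m m' : 'X_{1..N} => (m <= m')%O).
Proof.
split=> [m m'|m m'|m' m m''|m|m m' m''].
- exact: Order.TotalTheory.le_total.
- exact: Order.POrderTheory.le_anti.
- exact: Order.POrderTheory.le_trans.
- exact: le0m.
- by rewrite lemc_add2l.
Qed.

Lemma multinom_wf : well_founded (strict (fun m m' : 'X_{1..N} => (m <= m')%O)).
Proof.
elim/(@ltmwf N) => m IH; apply: Acc_intro => m'; rewrite /strict andbC.
by rewrite -Order.POrderTheory.lt_neqAle => /IH.
Qed.

(** Compares the weights [u] first and breaks the ties by [le]. *)
Definition refine u le : rel 'X_{1..N} :=
  fun m m' => (mwt u m < mwt u m')%N || (mwt u m == mwt u m') && le m m'.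

Lemma refine_term_order u le : term_order le -> term_order (refine u le).
Proof.
move=> [tot anti trans le0 add]; rewrite /refine; split=> [m m'|m m'|m' m m''|m|m m1 m2].
- by case: ltngtP => //= _; rewrite tot.
- by case: ltngtP => //= _ /anti.
- move=> /orP[lt|/andP[/eqP -> le1]] /orP[lt'|/andP[/eqP <- le2]].
  + by rewrite (ltn_trans lt lt').
  + by rewrite lt.
  + by rewrite lt'.
  + by rewrite eqxx (trans _ _ _ le1 le2) orbT.
- by rewrite mwt0 le0 andbT; case: (mwt u m).
- by rewrite !mwtD ltn_add2r eqn_add2r => /orP[->//|/andP[-> /add ->]]; rewrite orbT.
Qed.

Lemma refine_wf u le : well_founded (strict le) -> well_founded (strict (refine u le)).
Proof.
move=> wf m; move: {2}(mwt u m) (erefl (mwt u m)) => k.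
elim/ltn_ind: k m => k IHk m; elim/(well_founded_induction wf): m => m IHm mk.
apply: Acc_intro => m' /andP[/orP[lt _|/andP[/eqP e le'] ne]].
  by apply: IHk (erefl _); rewrite -mk.
by apply: IHm; rewrite ?e // /strict le'.
Qed.

Definition weight_order u h := refine u (refine h (fun m m' : 'X_{1..N} => (m <= m')%O)).

Lemma weight_order_term u h : term_order (weight_order u h).
Proof. by do 2!apply: refine_term_order; apply: multinom_term_order. Qed.

Lemma weight_order_wf u h : well_founded (strict (weight_order u h)).
Proof. by do 2!apply: refine_wf; apply: multinom_wf. Qed.

Variable K : fieldType.

Lemma wt_lead_leading u h mu (p : {mpoly K[N]}) :
  wt_lead u h mu p -> is_leading_monomial (weight_order u h) p mu.
Proof.
move=> lead; split; first by rewrite mcoeff_msupp (wt_lead_coeff lead).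
move=> m /(wt_lead_supp lead)[->|]; first exact/term_order_refl/weight_order_term.
rewrite /weight_order /refine /wt_below => /orP[->//|/andP[-> ->]].
by rewrite orbT.
Qed.

Lemma wt_lead_uniq u h mu nu (p : {mpoly K[N]}) : wt_lead u h mu p -> wt_lead u h nu p -> mu = nu.
Proof.
move=> l1 l2; have := weight_order_term u h => ord.
have [s1 m1] := wt_lead_leading l1; have [s2 m2] := wt_lead_leading l2.
by apply: (term_order_anti ord); [apply: m2 | apply: m1].
Qed.

Lemma mnm_pair_le i j m : i != j -> (0 < m i)%N -> (0 < m j)%N -> (U_(i) + U_(j) <= m)%MM.
Proof.
move=> ij mi mj; apply/mnm_lepP => k; rewrite mnmDE !mnm1E.
have [<-|ik] := eqVneq i k; first by rewrite eq_sym (negbTE ij) addn0.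
by have [<-|jk] := eqVneq j k; rewrite ?addn0.
Qed.
End WeightOrders.

Lemma ker0 (A B : nzRingType) (f : {rmorphism A -> B}) : ker f 0.
Proof. exact: rmorph0. Qed.
Lemma kerD (A B : nzRingType) (f : {rmorphism A -> B}) p q : ker f p -> ker f q -> ker f (p + q).
Proof. by rewrite /ker rmorphD => -> ->; rewrite addr0. Qed.
Lemma kerM (A B : nzRingType) (f : {rmorphism A -> B}) r p : ker f p -> ker f (r * p).
Proof. by rewrite /ker rmorphM => ->; rewrite mulr0. Qed.

(** Independence of the standard monomials gives generation and the Groebner
    property; distinct leading monomials in a single degree give irredundancy. *)
Lemma kernel_basis (K : fieldType) (N : nat) (T : finType) (g : T -> {mpoly K[N]})
    (l : T -> 'X_{1..N}) (u h : 'I_N -> nat) (D : nat)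
    (B : nzRingType) (f : {rmorphism {mpoly K[N]} -> B}) :
    (forall i, wt_lead u h (l i) (g i)) -> injective l ->
    (forall i m, m \in msupp (g i) -> mdeg m = D) -> (forall i, ker f (g i)) ->
    (forall p, ker f p -> (forall m, m \in msupp p -> standard l m) -> p = 0) ->
  minimally_generated_by (ker f) g /\
  exists le, term_order le /\ groebner_basis le (ker f) g.
Proof.
move=> lead l_inj hom2 gk indep; pose le := weight_order u h.
have ord : term_order le := weight_order_term u h.
have wf : well_founded (strict le) := @weight_order_wf N u h.
have ld i : is_leading_monomial le (g i) (l i) := wt_lead_leading (lead i).
split; last first.
  exists le; split; [exact: ord|].
  exact: (kernel_groebner ord wf ld (ker0 f) (@kerD _ _ f) (@kerM _ _ f) gk indep).
split; last exact: (distinct_leads_irredundant ord ld hom2 l_inj).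
by move=> p; split=> /(ideal_gen_kernel ord wf ld (ker0 f) (@kerD _ _ f) (@kerM _ _ f) gk indep).
Qed.

(** * Noncrossing graphs *)

Section Noncrossing.
Local Open Scope nat_scope.
Variables (C : finType) (pos rank : C -> nat).
Hypothesis pos_inj : injective pos.

Definition between (x a b : C) :=
  (pos a < pos x < pos b) || (pos b < pos x < pos a).

(** The chord from [a] to [b] crosses the one from [c] to [d], [c] being the end
    under it. *)
Definition crosses (a b c d : C) :=
  [&& between c a b, d != a, d != b & ~~ between d a b].

Hypothesis unimodal : forall a b x, between x a b -> rank x < maxn (rank a) (rank b).

(** [M] counts the edges of a multigraph, directed by increasing rank, and [X]
    counts legs, which go from a vertex to infinity. *)
Definition noncrossing (M : C -> C -> nat) (X : C -> nat) : Prop :=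
  [/\ forall a b, 0 < M a b -> rank a < rank b,
      forall a b c d, 0 < M a b -> 0 < M c d ->
        ~~ crosses a b c d && ~~ crosses a b d c &
      forall a b x, 0 < M a b -> 0 < X x -> ~~ between x a b].

Definition outdeg (M : C -> C -> nat) (X : C -> nat) a := \sum_b M a b + X a.
Definition indeg (M : C -> C -> nat) b := \sum_a M a b.

Lemma sum_gt0P (I : finType) (F : I -> nat) : 0 < \sum_i F i -> exists i, 0 < F i.
Proof.
move=> h; apply/existsP; apply: contraLR h; rewrite negb_exists => /forallP h.
by rewrite big1 // => i _; apply/eqP; rewrite -leqn0 leqNgt.
Qed.

Lemma indeg_gt0 (M : C -> C -> nat) a b : 0 < M a b -> 0 < indeg M b.
Proof. by move=> h; rewrite /indeg (bigD1 a) //=; lia. Qed.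

Lemma outdeg_gt0 (M : C -> C -> nat) X a b : 0 < M a b -> 0 < outdeg M X a.
Proof. by move=> h; rewrite /outdeg (bigD1 b) //=; lia. Qed.

Definition dist (a b : C) := (pos a - pos b) + (pos b - pos a).

(** If [a] is not the source [a0] of an edge to [b], it lies between [a0] and [b],
    as [b] is not under the chord from [a0] to [a] by unimodality.  A leg at [a]
    would then be under the edge from [a0] to [b].  An edge from [a] to [y] with
    [y] different from [b] would have to stay under it, so that [y] would have
    smaller rank than [b], against the choice of [b]. *)
Lemma forced_edge M X a b :
    noncrossing M X -> 0 < indeg M b ->
    (forall b', 0 < indeg M b' -> rank b <= rank b') ->
    0 < outdeg M X a -> rank a < rank b ->
    (forall a', 0 < outdeg M X a' -> rank a' < rank b -> dist a b <= dist a' b) ->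
  0 < M a b.
Proof.
move=> [Mlt Mnc Xnb] bin bmin aout ab amin.
have /sum_gt0P [a0 M0] := bin.
have a0b := Mlt _ _ M0.
have [-> // | ne] := eqVneq a a0.
have d0 := amin _ (outdeg_gt0 X M0) a0b.
have pa0 : pos a <> pos a0 by move/pos_inj; apply/eqP.
have pab : pos a <> pos b by move/pos_inj => e; move: ab; rewrite e ltnn.
have p0b : pos a0 <> pos b by move/pos_inj => e; move: a0b; rewrite e ltnn.
have nb : ~~ between b a0 a by apply/negP => /unimodal; lia.
have btw : between a a0 b by move: d0 nb; rewrite /between /dist; lia.
move: aout; rewrite /outdeg addn_gt0 => /orP[/sum_gt0P [y My]|Xa]; last first.
  by have := Xnb _ _ _ M0 Xa; rewrite btw.
have ay := Mlt _ _ My.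
have yin := bmin _ (indeg_gt0 My).
have [<- // | yb] := eqVneq y b.
have ya0 : y != a0 by apply/eqP => e; move: a0b; rewrite -e; lia.
have /andP[+ _] := Mnc _ _ _ _ M0 My.
rewrite /crosses btw ya0 yb /= negbK => /unimodal.
by lia.
Qed.

Definition remove_edge (M : C -> C -> nat) a b : C -> C -> nat :=
  fun a' b' => M a' b' - ((a' == a) && (b' == b)).

Lemma noncrossing_remove M X a b : noncrossing M X -> noncrossing (remove_edge M a b) X.
Proof.
have sub a' b' : 0 < remove_edge M a b a' b' -> 0 < M a' b' by rewrite /remove_edge; lia.
move=> [h1 h2 h3]; split=> [a' b' /sub|a' b' c d /sub M1 /sub|a' b' x /sub].
- exact: h1.
- exact: h2.
- exact: h3.
Qed.

Lemma outdeg_remove M X a b a' :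
  0 < M a b -> outdeg (remove_edge M a b) X a' = outdeg M X a' - (a' == a).
Proof.
move=> Mab; rewrite /outdeg /remove_edge; have [->|ne] /= := eqVneq a' a; last first.
  by rewrite subn0; congr (_ + _); apply: eq_bigr => b' _; rewrite subn0.
rewrite (bigD1 b) //= [in RHS](bigD1 b) //= eqxx.
rewrite (eq_bigr (fun b0 => M a b0)); last by move=> b0 /negbTE ->; rewrite subn0.
by lia.
Qed.

Lemma indeg_remove M a b b' :
  0 < M a b -> indeg (remove_edge M a b) b' = indeg M b' - (b' == b).
Proof.
move=> Mab; rewrite /indeg /remove_edge; have [->|ne] /= := eqVneq b' b; last first.
  by rewrite subn0; apply: eq_bigr => a' _; rewrite andbF subn0.
rewrite (bigD1 a) //= [in RHS](bigD1 a) //= eqxx.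
rewrite (eq_bigr (fun a' => M a' b)); last by move=> a' /negbTE ->; rewrite subn0.
by lia.
Qed.

(** An edge that is common to both graphs can be read off the degrees by
    [forced_edge]; remove it from both. *)
Lemma noncrossing_inj M X M' X' :
    noncrossing M X -> noncrossing M' X' ->
    outdeg M X =1 outdeg M' X' -> indeg M =1 indeg M' ->
  M =2 M' /\ X =1 X'.
Proof.
move: {2}(\sum_b indeg M b) (leqnn (\sum_b indeg M b)) => k.
elim: k M M' => [|k IH] M M' Mk nc nc' eo ei.
  have z N : \sum_b indeg N b <= 0 -> forall a b, N a b = 0.
    rewrite leqn0 sum_nat_eq0 => /forallP h a b; apply/eqP; rewrite -leqn0 leqNgt.
    by apply/negP => /indeg_gt0; have := h b; rewrite /= => /eqP ->.
  have M0 := z _ Mk; have M0' : forall a b, M' a b = 0.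
    by apply: z; rewrite -(eq_bigr _ (fun b _ => ei b)).
  split=> [a b|a]; first by rewrite M0 M0'.
  by have := eo a; rewrite /outdeg !big1.
have [|kpos] := leqP (\sum_b indeg M b) k; first by move=> h; apply: IH.
have /sum_gt0P [b0 b0in] : 0 < \sum_b indeg M b by lia.
case: (@arg_minnP _ b0 [pred b | 0 < indeg M b] rank b0in) => b /= bin bmin.
have /sum_gt0P [a0 M0] := bin.
have [Mlt _ _] := nc; have a0b := Mlt _ _ M0.
have a0P : [pred a | (0 < outdeg M X a) && (rank a < rank b)] a0 by rewrite /= a0b (outdeg_gt0 X M0).
case: (@arg_minnP _ a0 _ (fun a => dist a b) a0P) => a /= /andP[aout ab] amin.
have Mab : 0 < M a b.
  by apply: (forced_edge nc) => // a' h1 h2; apply: amin; rewrite /= h1.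
have Mab' : 0 < M' a b.
  apply: (forced_edge nc') => [|b'||//|a' h1 h2].
  - by rewrite -ei.
  - by rewrite -ei; apply: bmin.
  - by rewrite -eo.
  - by apply: amin; rewrite eo h1.
have [] := IH (remove_edge M a b) (remove_edge M' a b) _ (noncrossing_remove a b nc) (noncrossing_remove a b nc').
- rewrite (eq_bigr _ (fun b' _ => indeg_remove b' Mab)) (bigD1 b) //= eqxx.
  rewrite (eq_bigr (indeg M)); last by move=> b' /negbTE ->; rewrite subn0.
  by move: Mk; rewrite (bigD1 b) //=; lia.
- by move=> a'; rewrite !outdeg_remove // eo.
- by move=> b'; rewrite !indeg_remove // ei.
move=> eM eX; split=> // a' b'; have := eM a' b'; rewrite /remove_edge.
have [->|_] := eqVneq a' a; last by rewrite !subn0.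
by have [->|_] /= := eqVneq b' b; lia.
Qed.

End Noncrossing.

(** * Columns of the scroll matrix *)

Section Columns.
Local Open Scope nat_scope.
Variables (d : nat) (n : 'I_d -> nat).
Implicit Types (a b : 'I_(codim n)) (v : xvar n).

Definition block a : 'I_d := tagnat.sig1 (p_ := n) a.
Definition place a : 'I_(n (block a)) := tagnat.sig2 (p_ := n) a.

(** [r] is meant to be 0 or 1; it is a natural number to let [entry 1 a] follow
    [entry 0 a] in the block of [a]. *)
Definition entry (r : nat) a : xvar n :=
  Tagged (fun i => 'I_(n i).+1) (inord (r + place a) : 'I_(n (block a)).+1).

Lemma scroll_mxE (A : nzRingType) (x : xvar n -> A) (r : 'I_2) a :
  scroll_mx x r a = x (entry r a).
Proof. by rewrite /scroll_mx !mxE. Qed.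

Lemma xvar_eq v w : tag v = tag w -> nat_of_ord (tagged v) = nat_of_ord (tagged w) -> v = w.
Proof.
case: v => i j; case: w => i' j' /= e; subst i' => e.
by congr (Tagged _ _); apply: val_inj.
Qed.

Lemma entry_tagged r a : r <= 1 -> nat_of_ord (tagged (entry r a)) = r + place a.
Proof. by move=> r1; rewrite /= inordK //; have := ltn_ord (place a); lia. Qed.

(** Lexicographic in the place and then in the block. *)
Definition key v : nat := nat_of_ord (tagged v) * d + tag v.

Lemma key_inj : injective key.
Proof.
move=> v w; have dv := ltn_ord (tag v); have dw := ltn_ord (tag w).
have d0 : 0 < d by lia.
rewrite /key => e; apply: xvar_eq.
  by apply: val_inj; move: (congr1 (fun k => k %% d) e); rewrite !modnMDl !modn_small.
by move: (congr1 (fun k => k %/ d) e); rewrite !divnMDl // !divn_small // !addn0.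
Qed.

Lemma key_entry1 a : key (entry 1 a) = key (entry 0 a) + d.
Proof. by rewrite /key !entry_tagged //= mulSn; lia. Qed.

Definition col (i : 'I_d) (k : 'I_(n i)) : 'I_(codim n) := tagnat.Rank (p_ := n) i k.

Lemma block_col i (k : 'I_(n i)) : block (col k) = i.
Proof. exact: tagnat.Rank1K. Qed.

Lemma place_col i (k : 'I_(n i)) : place (col k) = k :> nat.
Proof. by rewrite /place /col tagnat.Rank2K. Qed.

Lemma col_block a : col (place a) = a.
Proof. exact: tagnat.sig2K. Qed.

Lemma colE i (k : 'I_(n i)) : col k = \sum_(j < d | j < i) n j + k :> nat.
Proof. exact: tagnat.RankEsum. Qed.

Lemma colP a : a = \sum_(j < d | j < block a) n j + place a :> nat.
Proof. by rewrite -{1}(col_block a) colE. Qed.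

Lemma entry_inj a b r : r <= 1 -> entry r a = entry r b -> a = b.
Proof.
move=> r1 e; have eb : block a = block b := congr1 tag e.
have := congr1 (fun v : xvar n => nat_of_ord (tagged v)) e; rewrite !entry_tagged // => /addnI ep.
apply: val_inj; rewrite /= (colP a) (colP b) ep; congr (_ + _).
by rewrite eb.
Qed.

Lemma sum_le_block (i j : 'I_d) :
  i < j -> \sum_(k < d | k <= i) n k <= \sum_(k < d | k < j) n k.
Proof.
move=> ij; rewrite [X in X <= _]big_mkcond [X in _ <= X]big_mkcond /=.
by apply: leq_sum => k _; case ki: (k <= i) => //; rewrite (leq_ltn_trans ki ij).
Qed.

Lemma sum_block (i : 'I_d) :
  \sum_(k < d | k <= i) n k = \sum_(k < d | k < i) n k + n i.
Proof.
rewrite (bigD1 i) //= addnC; congr (_ + _); apply: eq_bigl => k.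
by rewrite ltn_neqAle andbC.
Qed.

Lemma GamE a : (a \in Gam n) = ((place a).+1 < n (block a)).
Proof.
have ka := ltn_ord (place a).
(* [Gam] sums in the semiring nat *)
have -> : (a \in Gam n) = [forall i : 'I_d, a.+1 != \sum_(j < d | j <= i) n j] by rewrite inE.
apply/forallP/idP => [/(_ (block a))|lt i].
  by have := colP a; have := sum_block (block a); lia.
have [li|gi] := ltnP i (block a).
  by have := sum_le_block li; have := colP a; lia.
suff : \sum_(k < d | k <= block a) n k <= \sum_(k < d | k <= i) n k.
  by have := colP a; have := sum_block (block a); lia.
rewrite [X in X <= _]big_mkcond [X in _ <= X]big_mkcond /=.
by apply: leq_sum => k _; case ki: (k <= block a) => //; rewrite (leq_trans ki gi).
Qed.

Lemma entry_ordS a : a \in Gam n -> entry 0 (ordS a) = entry 1 a.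
Proof.
rewrite GamE => lt; suff -> : ordS a = col (Ordinal lt).
  apply: xvar_eq; first by rewrite /= block_col.
  by rewrite !entry_tagged // place_col.
have e : a.+1 = col (Ordinal lt) :> nat by rewrite colE /= addnS -colP.
by apply: val_inj; rewrite /= e modn_small.
Qed.

Lemma entry_last a b : a \notin Gam n -> entry 0 b <> entry 1 a.
Proof.
rewrite GamE => lt e; have eb : block b = block a := congr1 tag e.
have := congr1 (fun v : xvar n => nat_of_ord (tagged v)) e; rewrite !entry_tagged //.
by have : place b < n (block a) by [rewrite -eb ltn_ord]; lia.
Qed.

Lemma key_first v : d <= key v -> exists a, v = entry 1 a.
Proof.
case: v => i [[|k] lk]; rewrite /key /=; first by have := ltn_ord i; lia.
move=> _; have lt : k < n i by [].
exists (col (Ordinal lt)); apply: xvar_eq; first by rewrite /= block_col.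
by rewrite entry_tagged // place_col.
Qed.

End Columns.

(** * Thresholds *)

Section Thresholds.
Local Open Scope nat_scope.
Variables (d : nat) (n : 'I_d -> nat).
Implicit Types (a b i : 'I_(codim n)) (v : xvar n).

Local Notation xi1 := (@entry d n 0).
Local Notation xi2 := (@entry d n 1).

Definition ckey a := key (xi1 a).
Definition key_bound := (\max_(v : xvar n) key v).+1.

Lemma key_lt v : key v < key_bound.
Proof. by rewrite ltnS (leq_bigmax v). Qed.

Lemma ckey_lt a : ckey a < key_bound.
Proof. exact: key_lt. Qed.

Lemma ckey_inj : injective ckey.
Proof. by move=> a b /key_inj; apply: entry_inj. Qed.

(** By [ckey], except that the last columns of the blocks come after all the
    others. *)
Definition delta a := ckey a + (a \notin Gam n) * key_bound.

(** The last columns of the blocks stand to the left of [key_bound] in decreasing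
    order of [ckey], the other ones to the right in increasing order. *)
Definition pos a := if a \in Gam n then key_bound + ckey a else key_bound - ckey a.

Lemma delta_inj : injective delta.
Proof.
move=> a b; have := ckey_lt a; have := ckey_lt b => hb ha.
by rewrite /delta => e; apply: ckey_inj; move: e; case: (a \in _); case: (b \in _) => /=; lia.
Qed.

Lemma pos_inj : injective pos.
Proof.
move=> a b; have := ckey_lt a; have := ckey_lt b => hb ha.
rewrite /pos => e; case: (boolP (a \in _)) e => ga; case: (boolP (b \in _)) => gb e;
  by apply: ckey_inj; lia.
Qed.

(** Sum of [delta] over the columns of the block of [v] that precede [v]. *)
Definition wt v := \sum_(a | (block a == tag v) && (place a < tagged v)) delta a.

Lemma wt_xi2 a : wt (xi2 a) = wt (xi1 a) + delta a.
Proof.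
rewrite /wt (bigD1 a) /=; last by rewrite eqxx; have := entry_tagged a (leqnn 1); rewrite /= => ->.
rewrite addnC; congr (_ + _); apply: eq_bigl => b.
have := entry_tagged a (leqnn 1); rewrite /= => ->.
have := entry_tagged a (leq0n 1); rewrite /= => ->.
have [eb|] //= := eqVneq (block b) (block a).
rewrite add0n add1n ltnS; have [->|ne] := eqVneq b a; first by rewrite ltnn andbF.
rewrite andbT leq_eqVlt; have [e|//] := eqVneq (nat_of_ord (place b)) (place a).
case/eqP: ne; apply: (@entry_inj d n b a 0) => //; apply: xvar_eq => //.
by rewrite !entry_tagged // e.
Qed.

Section Threshold.
Variable i : 'I_(codim n).

(** The columns with [delta] at least [delta i] come after the other ones; [ckey]
    orders both classes. *)
Definition rank a := (delta i <= delta a) * key_bound + ckey a.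

Lemma rank_inj : injective rank.
Proof.
move=> a b; have := ckey_lt a; have := ckey_lt b => hb ha.
rewrite /rank => e; apply: ckey_inj; move: e.
by case: (_ <= delta a); case: (_ <= delta b) => /=; lia.
Qed.

Lemma rank_lt a : rank a < 2 * key_bound.
Proof. by have := ckey_lt a; rewrite /rank; case: (delta i <= delta a) => /=; lia. Qed.

(** On each side of [key_bound] the rank increases with the distance to
    [key_bound]. *)
Lemma rank_unimodal a b x : between pos x a b -> rank x < maxn (rank a) (rank b).
Proof.
have := ckey_lt a; have := ckey_lt b; have := ckey_lt x => hx hb ha.
have rank_mono y : (x \in Gam n) = (y \in Gam n) -> ckey x < ckey y -> rank x < rank y.
  move=> e lt; have ltd : delta x < delta y by rewrite /delta e ltn_add2r.
  by rewrite /rank; case: (leqP (delta i) (delta x)); case: (leqP (delta i) (delta y)) => /=; lia.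
rewrite leq_max /between /pos.
case gx: (x \in _); case ga: (a \in _); case gb: (b \in _) => h; apply/orP;
  first [ by left; apply: rank_mono; [rewrite ga gx | lia]
        | by right; apply: rank_mono; [rewrite gb gx | lia]
        | by have [|] := ltnP (ckey x) (ckey a); [left; apply: rank_mono; [rewrite ga gx | lia]
            | right; apply: rank_mono; [rewrite gb gx | lia]]
        | lia ].
Qed.

(** At the threshold [i] the variables [xi2 c] with [delta c > delta i] are
    negligible as first-row entries; the other ones are alive. *)
Definition alive v := [forall c, (xi2 c == v) ==> (delta c <= delta i)].

Lemma alive_xi2 a : alive (xi2 a) = (delta a <= delta i).
Proof.
apply/forallP/idP => [/(_ a)|le c]; first by rewrite eqxx.
by apply/implyP => /eqP /(@entry_inj d n c a 1 (leqnn _)) ->.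
Qed.

Lemma not_aliveP v : ~~ alive v -> exists2 c, v = xi2 c & delta i < delta c.
Proof.
rewrite negb_forall => /existsP[c]; rewrite negb_imply -ltnNge => /andP[/eqP <-].
by exists c.
Qed.

(** One end attains the cut-off [delta i] in the second row, and one end keeps its
    full weight in the first row. *)
Definition valid_edge a b :=
  ((delta i <= delta a) || (delta i <= delta b)) && (alive (xi1 a) || alive (xi1 b)).

(** If [xi1 a] were not alive, it would be [xi2 c] with [delta c] above the
    threshold.  As [key] increases by the constant [d] from the first row to the
    second row, [xi1 b] would be [xi2] of a column after [c], and not be alive
    either. *)
Lemma valid_edge_orient a b :
  valid_edge a b -> rank a < rank b -> alive (xi1 a) && (delta i <= delta b).
Proof.
have ha := ckey_lt a; have hb := ckey_lt b.
move=> /andP[vP vQ] lt; apply/andP; split; last first.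
  by apply: contraLR vP; move: lt; rewrite /rank -ltnNge negb_or; case: leqP; case: leqP => /=; lia.
apply: contraLR vQ => na; rewrite negb_or na /=.
have [c ac ic] := not_aliveP na.
have gc : c \in Gam n by apply: contraT => /(@entry_last d n c a); rewrite ac.
have ka : ckey a = ckey c + d by rewrite /ckey ac key_entry1.
have gi : i \in Gam n by apply: contraLR ic => gi; have := ckey_lt c; rewrite -leqNgt /delta gc gi; lia.
have kic : ckey i < ckey c by move: ic; rewrite /delta gc gi; lia.
have nPa : delta i <= delta a by rewrite /delta gi; lia.
have kab : ckey a < ckey b.
  by move: lt; rewrite /rank nPa; case: (_ <= delta b) => /=; lia.
have [|c' bc'] := @key_first d n (xi1 b); first by rewrite -/(ckey b); lia.
have gc' : c' \in Gam n by apply: contraT => /(@entry_last d n c' b); rewrite bc'.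
have kb : ckey b = ckey c' + d by rewrite /ckey bc' key_entry1.
by rewrite bc' alive_xi2 -ltnNge /delta gc' gi; lia.
Qed.

(** The weight [wt], cut off at the threshold. *)
Definition cut v :=
  if [pick c | xi2 c == v] is Some c then wt (xi1 c) + minn (delta c) (delta i) else wt v.

Lemma cut_xi2 a : cut (xi2 a) = wt (xi1 a) + minn (delta a) (delta i).
Proof.
rewrite /cut; case: pickP => [c /eqP /(@entry_inj d n c a 1 (leqnn _)) -> //|/(_ a)].
by rewrite eqxx.
Qed.

Lemma cut_alive v : alive v -> cut v = wt v.
Proof.
rewrite /cut; case: pickP => // c /eqP <-; rewrite alive_xi2 wt_xi2 => h.
by rewrite (minn_idPl h).
Qed.

Lemma cut_dead v : ~~ alive v -> cut v < wt v.
Proof. by move=> /not_aliveP[c -> ic]; rewrite cut_xi2 wt_xi2; lia. Qed.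

Lemma cut_le v : cut v <= wt v.
Proof. by have [/cut_alive ->|/cut_dead/ltnW] := boolP (alive v). Qed.

Definition height v :=
  if [pick a | xi1 a == v] is Some a then 2 * key_bound - rank a else 0.

Lemma height_xi1 a : height (xi1 a) = 2 * key_bound - rank a.
Proof.
rewrite /height; case: pickP => [c /eqP /(@entry_inj d n c a 0 isT) -> //|/(_ a)].
by rewrite eqxx.
Qed.

(** Prefers the smaller rank in the first row.  By [tie_xi2] it is constant on the
    second-row factors that lose no weight. *)
Definition tie v := if alive v then height v else height (xi2 i).

Lemma tie_xi2 b : delta i <= delta b -> tie (xi2 b) = height (xi2 i).
Proof.
rewrite /tie alive_xi2 leq_eqVlt => /orP[/eqP/delta_inj <-|]; first by rewrite leqnn.
by rewrite ltnNge => /negbTE ->.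
Qed.

End Threshold.
End Thresholds.

(** * Initial forms of the images of monomials *)

Section Leads.
Variables (K : fieldType) (d : nat) (n : 'I_d -> nat).
Implicit Types (a b i : 'I_(codim n)) (v : xvar n) (t : yvar n).

Local Notation V := (xvar n).
Local Notation W := (xvar n + yvar n)%type.
Local Notation xi1 := (@entry d n 0).
Local Notation xi2 := (@entry d n 1).

Definition end0 t := tnth (val t) 0.
Definition end1 t := tnth (val t) 1.

Lemma end_lt t : (end0 t < end1 t)%N.
Proof.
have /andP[+ _] := valP t; rewrite /end0 /end1.
case: (val t) => -[|a [|b [|c s]]] //= sz.
by rewrite !(tnth_nth a) /= andbT.
Qed.

Definition ux v : 'X_{1..#|{: V}|} := U_(enum_rank v)%MM.
Definition pair_mon a b := (ux (xi1 a) + ux (xi2 b))%MM.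

Lemma minor2E t :
  minor2 K t = 'X_[pair_mon (end0 t) (end1 t)] - 'X_[pair_mon (end1 t) (end0 t)].
Proof. by rewrite /minor2 !scroll_mxE /mvar !mpolyXD. Qed.

Definition on_vars (f : V -> nat) (k : 'I_#|{: V}|) := f (enum_val k).

Lemma mwt_ux f v : mwt (on_vars f) (ux v) = f v.
Proof. by rewrite mwtU /on_vars enum_rankK. Qed.

Lemma mwt_pair f a b : mwt (on_vars f) (pair_mon a b) = (f (xi1 a) + f (xi2 b))%N.
Proof. by rewrite mwtD !mwt_ux. Qed.

Section Threshold.
Variable i : 'I_(codim n).

Definition out t := if (rank i (end0 t) < rank i (end1 t))%N then end0 t else end1 t.
Definition inn t := if (rank i (end0 t) < rank i (end1 t))%N then end1 t else end0 t.

Lemma out_inn t : (rank i (out t) < rank i (inn t))%N.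
Proof.
rewrite /out /inn; case: (ltnP (rank i (end0 t))) => //; rewrite leq_eqVlt => /orP[/eqP/rank_inj e|//].
by have := end_lt t; rewrite e ltnn.
Qed.

(** The image of a variable after setting t = 1. *)
Definition img (w : W) : polyR K n :=
  match w with inl v => mvar K v | inr t => minor2 K t end.

Definition img_bound (w : W) : nat :=
  match w with inl v => wt v | inr t => (wt (xi1 (end0 t)) + wt (xi1 (end1 t)) + delta i)%N end.

Definition img_lead (w : W) : 'X_{1..#|{: V}|} :=
  match w with inl v => ux v | inr t => pair_mon (out t) (inn t) end.

Definition valid (w : W) : bool :=
  match w with inl v => alive i v | inr t => valid_edge i (end0 t) (end1 t) end.

Local Notation ucut := (on_vars (cut i)).
Local Notation utie := (on_vars (tie i)).

Lemma minor_supp t m : m \in msupp (minor2 K t) ->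
  m = pair_mon (end0 t) (end1 t) \/ m = pair_mon (end1 t) (end0 t).
Proof.
rewrite minor2E => /msuppB_le; rewrite mem_cat !msuppX !inE => /orP[] /eqP; by [left|right].
Qed.

Lemma img_le w : wt_le ucut (img_bound w) (img w).
Proof.
case: w => [v|t] m /=.
  by rewrite msuppX inE => /eqP ->; rewrite mwt_ux cut_le.
have h0 := cut_le i (xi1 (end0 t)); have h1 := cut_le i (xi1 (end1 t)).
by case/minor_supp => ->; rewrite mwt_pair cut_xi2; lia.
Qed.

Lemma img_lt w : ~~ valid w -> wt_lt ucut (img_bound w) (img w).
Proof.
case: w => [v|t] /= nv m.
  by rewrite msuppX inE => /eqP ->; rewrite mwt_ux cut_dead.
have h0 := cut_le i (xi1 (end0 t)); have h1 := cut_le i (xi1 (end1 t)).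
have {nv} : (delta (end0 t) < delta i)%N && (delta (end1 t) < delta i)%N ||
         (cut i (xi1 (end0 t)) < wt (xi1 (end0 t)))%N && (cut i (xi1 (end1 t)) < wt (xi1 (end1 t)))%N.
  move: nv; rewrite /valid_edge negb_and !negb_or -!ltnNge => /orP[->//|/andP[a0 a1]].
  by rewrite !cut_dead // orbT.
by move=> h; case/minor_supp => ->; rewrite mwt_pair cut_xi2; lia.
Qed.

Lemma valid_orient t : valid (inr t) -> alive i (xi1 (out t)) /\ (delta i <= delta (inn t))%N.
Proof.
move=> v; apply/andP/valid_edge_orient; last exact: out_inn.
move: v => /=; rewrite /out /inn /valid_edge; case: ifP => // _ /andP[h1 h2].
by rewrite orbC h1 orbC.
Qed.

Lemma img_lead_wt w : valid w -> mwt ucut (img_lead w) = img_bound w.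
Proof.
case: w => [v|t] vw; first by rewrite mwt_ux cut_alive.
have [al le] := valid_orient vw.
rewrite mwt_pair cut_xi2 (cut_alive al) (minn_idPr le) /=.
by rewrite /out /inn; case: ifP => _; lia.
Qed.

(** When both terms of the minor have the same cut weight, the tie-break compares
    the ranks of their first-row factors. *)
Lemma img_wt_lead w : valid w -> wt_lead ucut utie (img_lead w) (img w).
Proof.
case: w => [v|t] vw.
  exists 1, 0; rewrite oner_neq0 scale1r addr0; split=> // m; by rewrite msupp0.
have [al le] := valid_orient vw.
have [c c0 mE] : exists2 c : K, c != 0 &
    minor2 K t = c *: 'X_[pair_mon (out t) (inn t)] + (- c) *: 'X_[pair_mon (inn t) (out t)].
  rewrite minor2E /out /inn; case: ifP => _.
    by exists 1; rewrite ?oner_neq0 // scale1r scaleN1r.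
  by exists (-1); rewrite ?oppr_eq0 ?oner_neq0 // opprK scale1r scaleN1r addrC.
exists c, ((- c) *: 'X_[pair_mon (inn t) (out t)]); split=> // m /msuppZ_le.
rewrite msuppX inE => /eqP ->.
rewrite /wt_below !mwt_pair !cut_xi2 (minn_idPr le) (cut_alive al) (tie_xi2 le).
have lt := out_inn t; have lti := rank_lt i (inn t).
have cle := cut_le i (xi1 (inn t)).
have [al'|/cut_dead] := boolP (alive i (xi1 (inn t))); last by lia.
have [le'|] := leqP (delta i) (delta (out t)); last by lia.
rewrite (tie_xi2 le') /tie al al' !height_xi1 (cut_alive al').
by lia.
Qed.
End Threshold.
End Leads.

Section ReesMonomials.
Variables (K : fieldType) (d : nat) (n : 'I_d -> nat).
Implicit Types (a b i : 'I_(codim n)) (v : xvar n) (t : yvar n).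

Local Notation V := (xvar n).
Local Notation W := (xvar n + yvar n)%type.
Local Notation xi1 := (@entry d n 0).
Local Notation xi2 := (@entry d n 1).
Implicit Types (m : 'X_{1..#|{: W}|}) (w : W).

Definition on_rvars (f : W -> nat) (k : 'I_#|{: W}|) := f (enum_val k).
Definition expo m w : nat := m (enum_rank w).

Lemma mwtE f m : mwt (on_rvars f) m = (\sum_(w : W) expo m w * f w)%N.
Proof.
rewrite /mwt (reindex_onto (@enum_rank W) (@enum_val W xpredT)) /=; last by move=> k _; rewrite enum_valK.
by apply: eq_big => [w|w _]; rewrite /on_rvars enum_rankK ?eqxx.
Qed.

Definition is_y (w : W) : nat := if w is inr _ then 1 else 0.
Definition ydeg m := mwt (on_rvars is_y) m.

Lemma ydegE m : ydeg m = (\sum_(t : yvar n) expo m (inr t))%N.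
Proof.
rewrite /ydeg mwtE big_sumType /= big1 ?add0n => [|v _]; last by rewrite muln0.
by apply: eq_bigr => t _; rewrite muln1.
Qed.

Definition mon_img m : polyR K n := \prod_(k < #|{: W}|) img K (enum_val k) ^+ m k.

(** The power of t in the image of a monomial is its degree in the Y. *)
Lemma psi_reesE (p : polyRY K n) k :
  (psi_rees p)`_k = \sum_(m <- msupp p | ydeg m == k) p@_m *: mon_img m.
Proof.
rewrite /psi_rees /mmap coef_sum [RHS]big_mkcond /=; apply: eq_bigr => m _.
rewrite /= coefCM mul_mpolyC.
have -> : mmap1 (fun k0 : 'I_#|{: W}| => match enum_val k0 with
      | inl v => (mvar K v)%:P
      | inr t => minor2 K t *: 'X
      end) m = (mon_img m)%:P * 'X^(ydeg m).
  rewrite /mmap1 /mon_img rmorph_prod /ydeg /mwt.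
  rewrite (big_morph _ (@exprD _ 'X) (expr0 _)) -big_split /=; apply: eq_bigr => k0 _.
  rewrite rmorphXn /on_rvars /=; case: (enum_val k0) => [v|t] /=; first by rewrite muln0 expr0 mulr1.
  by rewrite muln1 -mul_polyC exprMn.
rewrite coefCM coefXn eq_sym; case: eqP => _; first by rewrite mulr1.
by rewrite mulr0 scaler0.
Qed.

Definition twt (w : W) : nat :=
  match w with inl v => wt v | inr t => (wt (xi1 (end0 t)) + wt (xi1 (end1 t)))%N end.

Section Threshold.
Variable i : 'I_(codim n).
Local Notation ucut := (on_vars (cut i)).
Local Notation utie := (on_vars (tie i)).

Definition mvalid m := [forall w, (0 < expo m w)%N ==> valid i w].

Definition mbound m := (mwt (on_rvars twt) m + delta i * ydeg m)%N.

Lemma mboundE m : mbound m = (\sum_(k < #|{: W}|) m k * img_bound i (enum_val k))%N.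
Proof.
rewrite /mbound /ydeg /mwt big_distrr -big_split; apply: eq_bigr => k _ /=.
by rewrite /on_rvars; case: (enum_val k) => [v|t] /=; lia.
Qed.

(** Leading monomial of the image, for the threshold [i]. *)
Definition mlead_img m : 'X_{1..#|{: V}|} :=
  (\sum_(k < #|{: W}|) img_lead i (enum_val k) *+ m k)%MM.

Lemma mon_img_lt m : ~~ mvalid m -> wt_lt ucut (mbound m) (mon_img m).
Proof.
rewrite negb_forall => /existsP[w]; rewrite negb_imply => /andP[mw nv].
rewrite mboundE /mon_img (bigD1 (enum_rank w)) // [X in wt_lt _ _ X](bigD1 (enum_rank w)) //=.
rewrite enum_rankK -/(expo m w) -(prednK mw) exprS mulSn -mulrA -addnA.
apply: wt_ltM; first exact: img_lt.
apply: wt_leM; first by apply: wt_leX; apply: img_le.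
rewrite -[X in wt_le _ X]big_filter -[X in wt_le _ _ X]big_filter.
by apply: wt_le_prod => k; apply: wt_leX; apply: img_le.
Qed.

Lemma mvalid_gt0 m k : mvalid m -> (0 < m k)%N -> valid i (enum_val k).
Proof. by move=> /forallP/(_ (enum_val k))/implyP; rewrite /expo enum_valK. Qed.

Lemma mlead_img_wt m : mvalid m -> mwt ucut (mlead_img m) = mbound m.
Proof.
move=> mv; rewrite /mlead_img mwt_sum mboundE; apply: eq_bigr => k _.
rewrite mwtMn; have [->|mk] := posnP (m k); first by rewrite !mul0n.
by rewrite img_lead_wt // (mvalid_gt0 mv).
Qed.

Lemma mon_img_lead m : mvalid m -> wt_lead ucut utie (mlead_img m) (mon_img m).
Proof.
move=> mv; apply: wt_lead_prod => k.
have [->|mk] := posnP (m k); first by rewrite expr0 mulm0n; apply: wt_lead1.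
by apply/wt_leadX/img_wt_lead/(mvalid_gt0 mv).
Qed.

(** Degrees of the lead monomial as a first-row and as a second-row monomial *)
Definition rowdeg1 m v := (expo m (inl v) + \sum_t expo m (inr t) * (xi1 (out i t) == v))%N.
Definition rowdeg2 m b := (\sum_t expo m (inr t) * (inn i t == b))%N.

Lemma mlead_imgE m v :
  mlead_img m (enum_rank v) =
  (rowdeg1 m v + \sum_t expo m (inr t) * (xi2 (inn i t) == v))%N.
Proof.
have E : mlead_img m (enum_rank v) = (\sum_(w : W) expo m w * img_lead i w (enum_rank v))%N.
  rewrite /mlead_img mnm_sumE.
  rewrite (reindex_onto (@enum_rank W) (@enum_val W xpredT)) /=; last by move=> k _; rewrite enum_valK.
  by apply: eq_big => [w|w _]; rewrite enum_rankK ?eqxx // mulmnE mulnC.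
have U v' : (ux v') (enum_rank v) = (v' == v) by rewrite mnm1E (inj_eq enum_rank_inj).
rewrite E big_sumType /rowdeg1 -addnA; congr (_ + _)%N.
  rewrite (bigD1 v) //= U eqxx muln1 big1 ?addn0 // => v' /negbTE ne.
  by rewrite U ne muln0.
by rewrite -big_split; apply: eq_bigr => t _; rewrite /img_lead mnmDE !U mulnDr.
Qed.

Lemma mlead_img_xi2 m b : mlead_img m (enum_rank (xi2 b)) = (rowdeg1 m (xi2 b) + rowdeg2 m b)%N.
Proof.
rewrite mlead_imgE; congr (_ + _)%N; apply: eq_bigr => t _; congr (_ * nat_of_bool _)%N.
by apply/eqP/eqP => [/(@entry_inj d n _ _ 1 (leqnn _))//|->].
Qed.

Lemma rowdeg1_alive m v : mvalid m -> (0 < rowdeg1 m v)%N -> alive i v.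
Proof.
move=> /forallP mv; rewrite /rowdeg1 addn_gt0 => /orP[h|/sum_gt0P[t]].
  by have /implyP/(_ h) := mv (inl v).
rewrite muln_gt0 => /andP[h]; case: eqP => // <- _.
by have /implyP/(_ h)/valid_orient[] := mv (inr t).
Qed.

Lemma rowdeg2_gt0 m b : mvalid m -> (0 < rowdeg2 m b)%N -> (delta i <= delta b)%N.
Proof.
move=> /forallP mv /sum_gt0P[t].
rewrite muln_gt0 => /andP[h]; case: eqP => // <- _.
by have /implyP/(_ h)/valid_orient[] := mv (inr t).
Qed.

Lemma sum_rowdeg2 m : (\sum_b rowdeg2 m b = ydeg m)%N.
Proof.
rewrite ydegE exchange_big; apply: eq_bigr => t _ /=.
by rewrite -big_distrr (bigD1 (inn i t)) //= eqxx big1 ?addn0 ?muln1 // => b; rewrite eq_sym => /negbTE ->.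
Qed.

(** For [delta b] above the threshold, [xi2 b] does not occur as a first-row
    factor, and for [delta b] below it there is no second-row factor in the
    column [b].  The column [i] is left, and the total number of second-row
    factors is known. *)
Lemma rowdeg2_eq m m' : mvalid m -> mvalid m' -> ydeg m = ydeg m' ->
  mlead_img m = mlead_img m' -> rowdeg2 m =1 rowdeg2 m'.
Proof.
move=> mv mv' ye le.
have ne b : b != i -> rowdeg2 m b = rowdeg2 m' b.
  move=> bi; have := congr1 (fun mu : 'X_{1.._} => mu (enum_rank (xi2 b))) le.
  rewrite !mlead_img_xi2; have [lt|gt] := leqP (delta i) (delta b).
    have dead m0 : mvalid m0 -> rowdeg1 m0 (xi2 b) = 0%N.
      move=> mv0; apply/eqP; rewrite -leqn0 leqNgt; apply/negP => /(rowdeg1_alive mv0).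
      rewrite alive_xi2 => gt; case/eqP: bi; apply/delta_inj/eqP.
      by rewrite eqn_leq gt lt.
    by rewrite !dead.
  have dead m0 : mvalid m0 -> rowdeg2 m0 b = 0%N.
    by move=> mv0; apply/eqP; rewrite -leqn0 leqNgt; apply/negP => /(rowdeg2_gt0 mv0); lia.
  by rewrite !dead.
move=> b; have [->|/ne//] := eqVneq b i.
have := sum_rowdeg2 m; have := sum_rowdeg2 m'; rewrite -ye => <-.
by rewrite (bigD1 i) //= [RHS](bigD1 i) //= (eq_bigr _ ne) => /addIn.
Qed.

Lemma rowdeg1_eq m m' : mvalid m -> mvalid m' -> ydeg m = ydeg m' ->
  mlead_img m = mlead_img m' -> rowdeg1 m =1 rowdeg1 m'.
Proof.
move=> mv mv' ye le v.
have := congr1 (fun mu : 'X_{1.._} => mu (enum_rank v)) le; rewrite !mlead_imgE.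
have E m0 : (\sum_t expo m0 (inr t) * (xi2 (inn i t) == v) = \sum_(b | xi2 b == v) rowdeg2 m0 b)%N.
  rewrite /rowdeg2 exchange_big; apply: eq_bigr => t _.
  rewrite -big_distrr; congr (_ * _)%N; rewrite big_mkcond (bigD1 (inn i t)) // eqxx.
  rewrite big1 ?addn0; first by case: eqP.
  by move=> b; rewrite eq_sym => /negbTE ->; case: eqP.
by rewrite !E (eq_bigr _ (fun b _ => rowdeg2_eq mv mv' ye le b)) => /addIn.
Qed.

End Threshold.
End ReesMonomials.

(** * Independence of the images of admissible monomials *)

Lemma sum_eq_andr (T : finType) (b : bool) (y : T) : (\sum_x (b && (y == x)) = b)%N.
Proof.
rewrite (bigD1 y) //= eqxx andbT big1 ?addn0 // => x.
by rewrite eq_sym => /negbTE ->; rewrite andbF.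
Qed.

Lemma sum_eq_andl (T : finType) (b : bool) (y : T) : (\sum_x ((y == x) && b) = b)%N.
Proof. by under eq_bigr do rewrite andbC; apply: sum_eq_andr. Qed.

Section Independence.
Variables (K : fieldType) (d : nat) (n : 'I_d -> nat).
Implicit Types (a b i : 'I_(codim n)) (v : xvar n) (t : yvar n).

Local Notation V := (xvar n).
Local Notation W := (xvar n + yvar n)%type.
Local Notation xi1 := (@entry d n 0).
Local Notation xi2 := (@entry d n 1).
Implicit Types (m : 'X_{1..#|{: W}|}) (w : W).
Local Notation pos := (@pos d n).

Lemma yvar_eq t t' : end0 t = end0 t' -> end1 t = end1 t' -> t = t'.
Proof.
rewrite /end0 /end1 => e0 e1; apply: val_inj; move: e0 e1.
case: (val t) => -[|a [|b [|? ?]]] //= sz; case: (val t') => -[|a' [|b' [|? ?]]] //= sz'.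
by rewrite !(tnth_nth a) /= => ea eb; apply: val_inj; rewrite /= ea eb.
Qed.

Definition max_delta t := maxn (delta (end0 t)) (delta (end1 t)).

(** The combinatorial form of being divisible by none of the four kinds of
    leading monomials. *)
Definition admissible m : Prop :=
  [/\ forall t t', (0 < expo m (inr t) -> 0 < expo m (inr t') ->
        ~~ crosses pos (end0 t) (end1 t) (end0 t') (end1 t') &&
        ~~ crosses pos (end0 t) (end1 t) (end1 t') (end0 t'))%N,
      forall t x, (0 < expo m (inr t) -> 0 < expo m (inl (xi1 x)) ->
        ~~ between pos x (end0 t) (end1 t))%N,
      forall t c, (0 < expo m (inr t) -> 0 < expo m (inl (xi2 c)) -> delta c <= max_delta t)%N &
      forall t t' c c', (0 < expo m (inr t) -> 0 < expo m (inr t') ->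
        end0 t \in Gam n -> end1 t \in Gam n ->
        xi1 (end0 t') = xi2 c -> xi1 (end1 t') = xi2 c' ->
        (delta c <= max_delta t) || (delta c' <= max_delta t))%N].

Section Threshold.
Variable i : 'I_(codim n).
Local Notation rank := (rank i).

Lemma out_innP t :
  (out i t = end0 t /\ inn i t = end1 t) \/ (out i t = end1 t /\ inn i t = end0 t).
Proof. by rewrite /out /inn; case: ifP; [left|right]. Qed.

Lemma edge_eq t t' : out i t = out i t' -> inn i t = inn i t' -> t = t'.
Proof.
have := end_lt t; have := end_lt t'.
case: (out_innP t) => -[-> ->]; case: (out_innP t') => -[-> ->] lt' lt e0 e1.
- exact: yvar_eq.
- by move: lt lt'; rewrite e0 e1; lia.
- by move: lt lt'; rewrite e0 e1; lia.
- exact: yvar_eq.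
Qed.

Definition edges m a b := (\sum_t expo m (inr t) * ((out i t == a) && (inn i t == b)))%N.
Definition legs m a := expo m (inl (xi1 a)).

Lemma edges_gt0 m a b : (0 < edges m a b)%N ->
  exists t, [/\ (0 < expo m (inr t))%N, out i t = a & inn i t = b].
Proof.
move=> /sum_gt0P[t]; rewrite muln_gt0 lt0b => /andP[mt /andP[/eqP ea /eqP eb]].
by exists t.
Qed.

Lemma edges_out_inn m t : edges m (out i t) (inn i t) = expo m (inr t).
Proof.
rewrite /edges (bigD1 t) // !eqxx muln1 big1 => [|t' ne]; first exact: addn0.
have [e0|_] := eqVneq (out i t') (out i t); last by rewrite muln0.
have [e1|_] := eqVneq (inn i t') (inn i t); last by rewrite muln0.
by move: ne; rewrite (edge_eq e0 e1) eqxx.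
Qed.

Lemma betweenC a b x : between pos x a b = between pos x b a.
Proof. by rewrite /between orbC. Qed.

Lemma crossesC a b c c' : crosses pos a b c c' = crosses pos b a c c'.
Proof.
rewrite /crosses (betweenC a b c) (betweenC a b c'); congr (_ && _).
by rewrite !andbA [(_ != b) && _]andbC.
Qed.

Lemma admissible_noncrossing m : admissible m -> noncrossing pos rank (edges m) (legs m).
Proof.
move=> [nc nb _ _]; split=> [a b|a b c c'|a b x] /edges_gt0[t [mt <- <-]].
- exact: out_inn.
- move=> /edges_gt0[t' [mt' <- <-]]; have /andP[h1 h2] := nc t t' mt mt'.
  by case: (out_innP t) => -[-> ->]; case: (out_innP t') => -[-> ->];
    rewrite ?[crosses pos (end1 t) _ _ _]crossesC h1 h2.
- move=> mx; have h := nb t x mt mx.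
  by case: (out_innP t) => -[-> ->] //; rewrite betweenC.
Qed.

Lemma outdeg_edges m a : outdeg (edges m) (legs m) a = rowdeg1 i m (xi1 a).
Proof.
rewrite /outdeg /rowdeg1 addnC; congr (_ + _)%N; rewrite exchange_big; apply: eq_bigr => t _.
rewrite -big_distrr; congr (_ * _)%N.
by rewrite (inj_eq (fun x y => @entry_inj d n x y 0 isT)) sum_eq_andr.
Qed.

Lemma indeg_edges m b : indeg (edges m) b = rowdeg2 i m b.
Proof.
rewrite /indeg exchange_big; apply: eq_bigr => t _.
by rewrite -big_distrr; congr (_ * _)%N; rewrite sum_eq_andl.
Qed.

(** Factoring the leading monomial into its first-row and second-row parts gives
    the degrees of the graph. *)
Lemma mlead_img_inj m m' :
    admissible m -> admissible m' -> mvalid i m -> mvalid i m' -> ydeg m = ydeg m' ->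
  mlead_img i m = mlead_img i m' -> m = m'.
Proof.
move=> am am' mv mv' ye le.
have eo : outdeg (edges m) (legs m) =1 outdeg (edges m') (legs m').
  by move=> a; rewrite !outdeg_edges (rowdeg1_eq mv mv' ye le).
have ei : indeg (edges m) =1 indeg (edges m').
  by move=> b; rewrite !indeg_edges (rowdeg2_eq mv mv' ye le).
have [eM _] := noncrossing_inj (@pos_inj d n) (@rank_unimodal d n i)
  (admissible_noncrossing am) (admissible_noncrossing am') eo ei.
have ey t : expo m (inr t) = expo m' (inr t) by rewrite -!edges_out_inn eM.
apply/mnmP => k; rewrite -[k]enum_valK; case: (enum_val k) => [v|t]; last exact: ey.
have := rowdeg1_eq mv mv' ye le v; rewrite /rowdeg1.
by rewrite (eq_bigr _ (fun t _ => congr1 (fun x => x * _)%N (ey t))) => /addIn.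
Qed.
End Threshold.

Lemma max_delta_attained t : exists i, delta i = max_delta t /\ (i = end0 t \/ i = end1 t).
Proof.
rewrite /max_delta; have [le|lt] := leqP (delta (end0 t)) (delta (end1 t)).
  by exists (end1 t); split; [|right].
by exists (end0 t); split; [|left].
Qed.

Hypothesis col0 : 'I_(codim n).

(** If there is an edge, the threshold is the end at which the smallest
    [max_delta] of an edge is attained, and a variable that is not valid at it would form, with this edge, a
    pair excluded by admissibility. *)
Lemma admissible_valid m : admissible m -> exists i, mvalid i m.
Proof.
move=> [nc nb sx sy].
have [/existsP[t0 mt0]|/existsPn noy] := boolP [exists t, (0 < expo m (inr t))%N]; last first.
  case: (@arg_maxnP _ col0 xpredT (@delta d n) isT) => i _ imax.
  exists i; apply/forallP => -[v|t]; apply/implyP => h; last by have := noy t; rewrite h.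
  by apply/forallP => c; apply/implyP => _; apply: imax.
case: (@arg_minnP _ t0 [pred t | 0 < expo m (inr t)]%N max_delta mt0) => t /= mt tmin.
have [i [di _]] := max_delta_attained t.
exists i; apply/forallP => -[v|t'] /=; apply/implyP => h.
  by apply/forallP => c; apply/implyP => /eqP e; rewrite di; apply: sx; rewrite ?e.
apply/andP; split; first by have := tmin _ h; rewrite -di /max_delta leq_max.
apply: contraT; rewrite negb_or => /andP[/not_aliveP[c e ic] /not_aliveP[c' e' ic']].
have gc : c \in Gam n by apply: contraT => /(@entry_last d n c (end0 t')); rewrite e.
have lt x : (delta x <= delta i)%N -> x \in Gam n.
  move=> le; apply: contraLR ic => gx; have := ckey_lt c; move: le; rewrite /delta gc gx /=; lia.
have g0 : end0 t \in Gam n by apply: lt; rewrite di leq_maxl.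
have g1 : end1 t \in Gam n by apply: lt; rewrite di leq_maxr.
by have /orP[] := sy t t' c c' mt h g0 g1 e e'; rewrite -di; lia.
Qed.

Lemma arg_max_seq (T : eqType) (s : seq T) (P : pred T) (f : T -> nat) x :
  x \in s -> P x -> exists y, [/\ y \in s, P y & forall z, z \in s -> P z -> (f z <= f y)%N].
Proof.
elim: s x => // z s IH x.
have [/hasP[x' x's Px']|/hasPn no] := boolP (has P s); last first.
  rewrite inE => /orP[/eqP -> Px|/no/negbTE ->//].
  exists z; split=> // [|z']; first exact: mem_head.
  by rewrite inE => /orP[/eqP -> //|/no/negbTE ->].
have [y [ys Py ymax]] := IH x' x's Px' => _ _.
have [/andP[Pz lt]|nz] := boolP (P z && (f y < f z)%N).
  exists z; split=> // [|z']; first exact: mem_head.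
  by rewrite inE => /orP[/eqP ->|z's /(ymax _ z's)] //; lia.
exists y; split=> // [|z']; first by rewrite inE ys orbT.
rewrite inE => /orP[/eqP -> Pz|]; last exact: ymax.
by move: nz; rewrite Pz /= -leqNgt.
Qed.

(** Let [m0] have the largest weight among the monomials with nonzero coefficient,
    and let [i] be a threshold for [m0].  Among the monomials of that weight that
    are valid at [i], choose [m1] whose image has the largest leading monomial:
    only the image of [m1] contains it. *)
Lemma admissible_free k (s : seq 'X_{1..#|{: W}|}) (c : 'X_{1..#|{: W}|} -> K) :
    uniq s -> (forall m, m \in s -> admissible m /\ ydeg m = k) ->
    \sum_(m <- s) c m *: mon_img K m = 0 ->
  forall m, m \in s -> c m = 0.
Proof.
move=> us adm s0 mm mms; apply/eqP; apply: contraT => cmm; exfalso.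
have [m0 [m0s c0 m0max]] := @arg_max_seq _ s (fun m => c m != 0)
  (mwt (on_rvars (@twt d n))) mm mms cmm.
have [i mv0] := admissible_valid (adm _ m0s).1.
pose P m := [&& c m != 0, mvalid i m & mwt (on_rvars (@twt d n)) m == mwt (on_rvars (@twt d n)) m0].
have [|m1 [m1s /and3P[c1 mv1 /eqP m1w] m1max]] :=
  @arg_max_seq _ s P (fun m => mwt (on_vars (tie i)) (mlead_img i m)) m0 m0s.
  by rewrite /P c0 mv0 eqxx.
have [am1 m1k] := adm _ m1s.
move/(congr1 (mcoeff (mlead_img i m1))): s0; rewrite mcoeff0 raddf_sum /=.
rewrite (bigD1_seq m1) //= big_seq_cond big1 ?addr0.
  by move/eqP; rewrite mcoeffZ mulf_eq0 (negbTE (wt_lead_coeff (mon_img_lead K mv1))) orbF (negbTE c1).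
move=> m /andP[ms ne]; rewrite mcoeffZ; have [->|cm] := eqVneq (c m) 0; first by rewrite mul0r.
rewrite (_ : _@_(mlead_img i m1) = 0) ?mulr0 //.
apply/memN_msupp_eq0/negP => h; have [am mk] := adm _ ms.
have w1 := mlead_img_wt mv1; have wm := m0max m ms cm.
have b1 : mbound i m1 = (mwt (on_rvars (@twt d n)) m0 + delta i * k)%N by rewrite /mbound m1w m1k.
have bm : mbound i m = (mwt (on_rvars (@twt d n)) m + delta i * k)%N by rewrite /mbound mk.
have [mv|nv] := boolP (mvalid i m); last first.
  by have := mon_img_lt nv h; rewrite w1 b1 bm ltn_add2r ltnNge wm.
have wlm := mlead_img_wt mv.
have [e|] := wt_lead_supp (mon_img_lead K mv) h.
  by case/eqP: ne; apply: (mlead_img_inj am am1 mv mv1) => //; rewrite mk m1k.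
rewrite /wt_below w1 wlm b1 bm ltn_add2r ltnNge wm /= eqn_add2r.
rewrite eq_sym => /andP[e]; have /(m1max _ ms) : P m by rewrite /P cm mv.
by move=> le; rewrite ltnNge le.
Qed.

Lemma admissible_independent (p : polyRY K n) :
  psi_rees p = 0 -> (forall m, m \in msupp p -> admissible m) -> p = 0.
Proof.
move=> psi0 adm; apply/mpolyP => m; rewrite mcoeff0.
have [mp|/memN_msupp_eq0 //] := boolP (m \in msupp p).
apply: (@admissible_free (ydeg m) [seq m' <- msupp p | ydeg m' == ydeg m] (fun m' => p@_m') _ _ _ m).
- by rewrite filter_uniq ?msupp_uniq.
- by move=> m'; rewrite mem_filter => /andP[/eqP -> /adm].
- by rewrite big_filter -psi_reesE psi0 coef0.
- by rewrite mem_filter eqxx.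
Qed.
End Independence.

(** * Relations indexed by unordered tuples of columns *)

Section Sorting.
Variable c : nat.
Implicit Types x y z w : 'I_c.

(** A statement about unordered triples may be proved for increasing ones. *)
Lemma sort3 (Q : 'I_c -> 'I_c -> 'I_c -> Prop) :
    (forall x y z, Q x y z -> Q y x z) -> (forall x y z, Q x y z -> Q x z y) ->
    (forall x y z, (x < y < z)%N -> Q x y z) ->
  forall x y z, uniq [:: x; y; z] -> Q x y z.
Proof.
move=> s12 s23 base.
have H x y z : (x < y)%N -> z != x -> z != y -> Q x y z.
  rewrite -!val_eqE /= => xy zx zy; have [yz|zy'] := ltnP y z; first by apply: base; lia.
  have [xz|zx'] := ltnP x z; first by apply/s23/base; lia.
  by apply/s23/s12/base; lia.
move=> x y z /=; rewrite !inE -!val_eqE /= => u; have [xy|yx] := ltnP x y.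
  by apply: H; rewrite -?val_eqE /=; lia.
by apply/s12/H; rewrite -?val_eqE /=; lia.
Qed.

Lemma sort4 (Q : 'I_c -> 'I_c -> 'I_c -> 'I_c -> Prop) :
    (forall x y z w, Q x y z w -> Q y x z w) -> (forall x y z w, Q x y z w -> Q x z y w) ->
    (forall x y z w, Q x y z w -> Q x y w z) ->
    (forall x y z w, (x < y)%N -> (y < z < w)%N -> Q x y z w) ->
  forall x y z w, uniq [:: x; y; z; w] -> Q x y z w.
Proof.
move=> s12 s23 s34 base.
have H3 x y z w : (x < y < z)%N -> w != x -> w != y -> w != z -> Q x y z w.
  rewrite -!val_eqE /= => xyz wx wy wz.
  have [zw|wz'] := ltnP z w; first by apply: base; lia.
  have [yw|wy'] := ltnP y w; first by apply/s34/base; lia.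
  have [xw|wx'] := ltnP x w; first by apply/s34/s23/base; lia.
  by apply/s34/s23/s12/base; lia.
have H2 x y z w : (x < y)%N -> uniq [:: x; y; z; w] -> Q x y z w.
  rewrite /= !inE -!val_eqE /= => xy u.
  have [yz|zy'] := ltnP y z; first by apply: H3; rewrite -?val_eqE /=; lia.
  have [xz|zx'] := ltnP x z; first by apply/s23/H3; rewrite -?val_eqE /=; lia.
  by apply/s23/s12/H3; rewrite -?val_eqE /=; lia.
move=> x y z w u; have [xy|yx] := ltnP x y; first exact: H2.
by apply/s12/H2; move: u; rewrite /= !inE -!val_eqE /=; lia.
Qed.

Lemma incr_inj (G : {set 'I_c}) k (s s' : incr G k) : perm_eq (val s) (val s') -> s = s'.
Proof.
move=> p; apply/val_inj/val_inj.
have /andP[ss _] := valP s; have /andP[ss' _] := valP s'.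
apply: (irr_sorted_eq _ _ ss ss' (perm_mem p)).
- by move=> y x z /= xy yz; apply: ltn_trans xy yz.
- by move=> x /=; rewrite ltnn.
Qed.

Lemma incr_uniq (G : {set 'I_c}) k (s : incr G k) : uniq (val s).
Proof.
have /andP[ss _] := valP s; apply: (sorted_uniq _ _ ss).
- by move=> y x z /= xy yz; apply: ltn_trans xy yz.
- by move=> x /=; rewrite ltnn.
Qed.

Lemma incr_in (G : {set 'I_c}) k (s : incr G k) x : x \in val s -> x \in G.
Proof. by have /andP[_ /allP] := valP s; apply. Qed.

Lemma incr_mk3 (G : {set 'I_c}) x y z : (x < y < z)%N -> all (mem G) [:: x; y; z] ->
  exists s : incr G 3, val s = [tuple x; y; z].
Proof.
move=> lt inG; have h : increasing G [tuple x; y; z] by rewrite /increasing inG andbT /=; lia.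
by exists (exist (fun s : 3.-tuple 'I_c => increasing G s) _ h).
Qed.

Lemma incr_mk4 (G : {set 'I_c}) x y z w : (x < y)%N -> (y < z < w)%N ->
  all (mem G) [:: x; y; z; w] -> exists s : incr G 4, val s = [tuple x; y; z; w].
Proof.
move=> lt lt' inG; have h : increasing G [tuple x; y; z; w] by rewrite /increasing inG andbT /=; lia.
by exists (exist (fun s : 4.-tuple 'I_c => increasing G s) _ h).
Qed.

End Sorting.

Section Edges.
Variables (d : nat) (n : 'I_d -> nat).
Implicit Types (a b x y z w : 'I_(codim n)) (t : yvar n).

Definition edge a b : option (yvar n) :=
  if (a < b)%N then insub [tuple a; b] else insub [tuple b; a].

Lemma edge_some a b t : (a < b)%N -> end0 t = a -> end1 t = b -> insub [tuple a; b] = Some t.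
Proof.
move=> lt e0 e1; have h : increasing [set: 'I_(codim n)] [tuple a; b].
  by rewrite /increasing /= !inE lt.
by rewrite insubT; congr Some; apply: yvar_eq; rewrite ?e0 ?e1.
Qed.

Lemma edge_lt a b : (a < b)%N -> exists2 t, edge a b = Some t & end0 t = a /\ end1 t = b.
Proof.
move=> lt; have h : increasing [set: 'I_(codim n)] [tuple a; b].
  by rewrite /increasing /= !inE lt.
by exists (exist (fun s : 2.-tuple 'I_(codim n) => increasing _ s) _ h); rewrite ?/edge ?lt ?insubT.
Qed.

Lemma edge_sym a b : edge a b = edge b a.
Proof.
rewrite /edge; case: ltngtP => // e.
by rewrite (val_inj e).
Qed.

Lemma edge_ends t : edge (end0 t) (end1 t) = Some t.
Proof. by rewrite /edge (end_lt t); apply: edge_some => //; apply: end_lt. Qed.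

Definition ends t a b := (end0 t = a /\ end1 t = b) \/ (end0 t = b /\ end1 t = a).

Lemma ends_refl t : ends t (end0 t) (end1 t).
Proof. by left. Qed.

Lemma edgeP a b : a != b -> exists2 t, edge a b = Some t & ends t a b.
Proof.
rewrite -val_eqE /= neq_ltn => /orP[/edge_lt[t et e]|/edge_lt[t et e]].
  by exists t => //; left.
by exists t; [rewrite edge_sym | right].
Qed.

Lemma ycoordE (A : nzRingType) (Y : yvar n -> A) a b :
  (a < b)%N -> ycoord Y a b = oapp Y 0 (edge a b).
Proof. by move=> lt; rewrite /ycoord /edge lt. Qed.

Lemma ordS_Gam a : a \in Gam n -> ordS a = a.+1 :> nat.
Proof.
move=> ga; rewrite /= modn_small //.
have lt : ((place a).+1 < n (block a))%N by rewrite -GamE.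
have := ltn_ord (col (Ordinal lt)).
by rewrite colE /= addnS -colP.
Qed.

End Edges.

Section Quadrics.
Variables (K : fieldType) (d : nat) (n : 'I_d -> nat).
Variables (N : nat) (jy : yvar n -> 'I_N).
Hypothesis jy_inj : injective jy.
Implicit Types (a b x y z w : 'I_(codim n)) (t : yvar n).

Let Y t : {mpoly K[N]} := 'X_(jy t).

(** The value 0 is taken on the diagonal only. *)
Definition edge_mon a b : 'X_{1..N} := oapp (fun t => U_(jy t)%MM) 0%MM (edge a b).

Lemma edge_mon_sym a b : edge_mon a b = edge_mon b a.
Proof. by rewrite /edge_mon edge_sym. Qed.

Lemma edge_mon_ends t a b : ends t a b -> edge_mon a b = U_(jy t)%MM.
Proof. by case=> -[<- <-]; rewrite /edge_mon ?[edge (end1 t) _]edge_sym edge_ends. Qed.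

Lemma ycoord_edge_mon a b : (a < b)%N -> ycoord Y a b = 'X_[edge_mon a b].
Proof. by move=> lt; rewrite ycoordE // /edge_mon; case: (edge_lt lt) => t ->. Qed.

Definition quadric_mon a b x y := (edge_mon a b + edge_mon x y)%MM.

Lemma quadric_mon_ends t t' a b x y :
  ends t a b -> ends t' x y -> quadric_mon a b x y = (U_(jy t) + U_(jy t'))%MM.
Proof. by move=> tab txy; rewrite /quadric_mon (edge_mon_ends tab) (edge_mon_ends txy). Qed.

Lemma quadric_monC a b x y : quadric_mon a b x y = quadric_mon x y a b.
Proof. by rewrite /quadric_mon addmC. Qed.

Lemma quadric_mon_swapl a b x y : quadric_mon a b x y = quadric_mon b a x y.
Proof. by rewrite /quadric_mon edge_mon_sym. Qed.

Lemma quadric_mon_swapr a b x y : quadric_mon a b x y = quadric_mon a b y x.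
Proof. by rewrite /quadric_mon [edge_mon x y]edge_mon_sym. Qed.

(** The relation indexed by [s] involves the columns [x, y, z, w], listed in any
    order.  Its coefficients are signs, which depend on the order. *)
Definition plucker_at (s : incr [set: 'I_(codim n)] 4) x y z w : Prop :=
  perm_eq (val s) [:: x; y; z; w] /\
  exists c1 c2 c3 : K, [/\ c1 != 0, c2 != 0, c3 != 0 &
    plucker_rel Y s = c1 *: 'X_[quadric_mon x y z w] + c2 *: 'X_[quadric_mon x z y w] + c3 *: 'X_[quadric_mon x w y z]].

Lemma tnth_mk4 (T : Type) (x y z w : T) :
  [/\ tnth [tuple x; y; z; w] 0 = x, tnth [tuple x; y; z; w] 1 = y,
      tnth [tuple x; y; z; w] 2 = z & tnth [tuple x; y; z; w] 3 = w].
Proof. by []. Qed.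

Lemma perm_swap12 (T : eqType) (s : seq T) (x y : T) r : perm_eq s (x :: y :: r) -> perm_eq s (y :: x :: r).
Proof. by move=> h; apply: perm_trans h _; rewrite (perm_catCA [:: x] [:: y]). Qed.

Lemma perm_swap23 (T : eqType) (s : seq T) (v x y : T) r :
  perm_eq s (v :: x :: y :: r) -> perm_eq s (v :: y :: x :: r).
Proof. by move=> h; apply: perm_trans h _; rewrite perm_cons (perm_catCA [:: x] [:: y]). Qed.

Lemma perm_swap34 (T : eqType) (s : seq T) (u v x y : T) r :
  perm_eq s (u :: v :: x :: y :: r) -> perm_eq s (u :: v :: y :: x :: r).
Proof. by move=> h; apply: perm_trans h _; rewrite !perm_cons (perm_catCA [:: x] [:: y]). Qed.

Lemma plucker_index x y z w : uniq [:: x; y; z; w] -> exists s, plucker_at s x y z w.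
Proof.
move: x y z w; apply: sort4 => [x y z w|x y z w|x y z w|x y z w xy yzw].
- move=> [s [p [c1 [c2 [c3 [n1 n2 n3 e]]]]]]; exists s; split; first exact: perm_swap12.
  by exists c1, c3, c2; split=> //; rewrite e (quadric_mon_swapl y x) [quadric_mon y z _ _]quadric_monC [quadric_mon y w _ _]quadric_monC addrAC.
- move=> [s [p [c1 [c2 [c3 [n1 n2 n3 e]]]]]]; exists s; split; first exact: perm_swap23.
  by exists c2, c1, c3; split=> //; rewrite e (quadric_mon_swapr x w z y) [c2 *: _ + _]addrC.
- move=> [s [p [c1 [c2 [c3 [n1 n2 n3 e]]]]]]; exists s; split; first exact: perm_swap34.
  by exists c1, c3, c2; split=> //; rewrite e (quadric_mon_swapr x y w z) addrAC.
have [|s sE] := @incr_mk4 _ [set: 'I_(codim n)] x y z w xy yzw; first by rewrite /= !inE.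
exists s; split; first by rewrite sE.
exists 1, (-1), 1; rewrite oppr_eq0 oner_neq0; split=> //.
rewrite /plucker_rel sE; have [-> -> -> ->] := tnth_mk4 x y z w.
by rewrite !ycoord_edge_mon -?mpolyXD ?scale1r ?scaleN1r //; lia.
Qed.

Definition shifted_at (s : incr (Gam n) 4) x y z w : Prop :=
  let S := @ordS _ in
  perm_eq (val s) [:: x; y; z; w] /\
  exists c1 c2 c3 c4 c5 c6 : K, c1 != 0 /\ [/\ c2 != 0, c3 != 0, c4 != 0, c5 != 0 & c6 != 0] /\
    shifted_rel Y s =
      c1 *: 'X_[quadric_mon x y (S z) (S w)] + c2 *: 'X_[quadric_mon x z (S y) (S w)]
    + c3 *: 'X_[quadric_mon x w (S y) (S z)] + c4 *: 'X_[quadric_mon y z (S x) (S w)]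
    + c5 *: 'X_[quadric_mon y w (S x) (S z)] + c6 *: 'X_[quadric_mon z w (S x) (S y)].

Lemma shifted_index x y z w :
  uniq [:: x; y; z; w] -> all (mem (Gam n)) [:: x; y; z; w] -> exists s, shifted_at s x y z w.
Proof.
move: x y z w; apply: sort4 => [x y z w h|x y z w h|x y z w h|x y z w xy yzw inG].
- move=> inG; have [|s [p [c1 [c2 [c3 [c4 [c5 [c6 [n1 [[n2 n3 n4 n5 n6] e]]]]]]]]]] := h.
    by move: inG => /= /and5P[-> -> -> ->].
  exists s; split; first exact: perm_swap12.
  exists c1, c4, c5, c2, c3, c6; do !split=> //.
  by rewrite e (quadric_mon_swapl y x) (quadric_mon_swapr z w); ring.
- move=> inG; have [|s [p [c1 [c2 [c3 [c4 [c5 [c6 [n1 [[n2 n3 n4 n5 n6] e]]]]]]]]]] := h.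
    by move: inG => /= /and5P[-> -> -> ->].
  exists s; split; first exact: perm_swap23.
  exists c2, c1, c3, c4, c6, c5; do !split=> //.
  by rewrite e (quadric_mon_swapr x w) (quadric_mon_swapl z y); ring.
- move=> inG; have [|s [p [c1 [c2 [c3 [c4 [c5 [c6 [n1 [[n2 n3 n4 n5 n6] e]]]]]]]]]] := h.
    by move: inG => /= /and5P[-> -> -> ->].
  exists s; split; first exact: perm_swap34.
  exists c1, c3, c2, c5, c4, c6; do !split=> //.
  by rewrite e (quadric_mon_swapr x y) (quadric_mon_swapl w z); ring.
have [s sE] := incr_mk4 xy yzw inG.
exists s; split; first by rewrite sE.
move: inG => /= /and5P[gx gy gz gw _].
exists 1, (-1), 1, 1, (-1), 1; rewrite oppr_eq0 oner_neq0; do !split=> //.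
rewrite /shifted_rel sE; have [-> -> -> ->] := tnth_mk4 x y z w.
by rewrite !ycoord_edge_mon -?mpolyXD ?scale1r ?scaleN1r // ?ordS_Gam //; lia.
Qed.

End Quadrics.

(** * Leading monomials of the relations *)

Section Chords.
Local Open Scope nat_scope.
Variable L : nat.

(** Product of the two arcs cut off by the points [x] and [y] on a circle of
    length [L]. *)
Definition chord x y := (x - y + (y - x)) * (L - (x - y + (y - x))).

Definition separates x y z w := (minn x y < z < maxn x y) (+) (minn x y < w < maxn x y).

Lemma chordC x y : chord x y = chord y x.
Proof. by rewrite /chord addnC. Qed.

(** If the four consecutive arcs are [a], [b], [e], [k], the two differences are
    [2 a e] and [2 b k]. *)
Lemma chord_sorted x y z w : x < y < z -> z < w < x + L ->
  (chord x y + chord z w < chord x z + chord y w) && (chord x w + chord y z < chord x z + chord y w).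
Proof.
move=> /andP[xy yz] /andP[zw wL].
have [a ya] : exists a, y = x + a.+1 by exists (y - x).-1; lia.
have [b zb] : exists b, z = x + a.+1 + b.+1 by exists (z - y).-1; lia.
have [e we] : exists e, w = x + a.+1 + b.+1 + e.+1 by exists (w - z).-1; lia.
have [k Lk] : exists k, L = a.+1 + b.+1 + e.+1 + k.+1 by exists (L - (w - x)).-1; lia.
have E p q s r : q = p + s -> L = s + r -> chord p q = s * r.
  by move=> -> Ls; rewrite /chord Ls; congr (_ * _); lia.
rewrite (@E x y a.+1 (b.+1 + e.+1 + k.+1)) ?(@E z w e.+1 (a.+1 + b.+1 + k.+1));
  rewrite ?(@E x z (a.+1 + b.+1) (e.+1 + k.+1)) ?(@E y w (b.+1 + e.+1) (a.+1 + k.+1));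
  rewrite ?(@E x w (a.+1 + b.+1 + e.+1) k.+1) ?(@E y z b.+1 (a.+1 + e.+1 + k.+1));
  by lia.
Qed.

Lemma chord_separates x y z w : uniq [:: x; y; z; w] -> separates x y z w ->
    x < L -> y < L -> z < L -> w < L ->
  (chord x z + chord y w < chord x y + chord z w) && (chord x w + chord y z < chord x y + chord z w).
Proof.
wlog xy : x y / x < y => [W u s xL yL zL wL|].
  have [xy|yx] := ltnP x y; first exact: W.
  have u' : uniq [:: y; x; z; w] by move: u; rewrite /= !inE; lia.
  have s' : separates y x z w by move: s; rewrite /separates minnC maxnC.
  have lt : y < x by move: u; rewrite /= !inE; lia.
  by have := W y x lt u' s' yL xL zL wL; rewrite (chordC y x); lia.
wlog zw : z w / z < w => [W u s xL yL zL wL|].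
  have [zw|wz] := ltnP z w; first exact: W.
  have u' : uniq [:: x; y; w; z] by move: u; rewrite /= !inE; lia.
  have s' : separates x y w z by move: s; rewrite /separates addbC.
  have lt : w < z by move: u; rewrite /= !inE; lia.
  by have := W w z lt u' s' xL yL wL zL; rewrite (chordC w z); lia.
rewrite /= !inE => u; rewrite /separates (minn_idPl (ltnW xy)) (maxn_idPr (ltnW xy)) => s xL yL zL wL.
have : (x < z < y /\ y < w) \/ (z < x < w /\ w < y) by lia.
case=> -[lt lt'].
  by have := @chord_sorted x z y w; rewrite (chordC z y); lia.
by have := @chord_sorted z x w y; rewrite (chordC z x) (chordC z y) (chordC z w) (chordC w y); lia.
Qed.

(** Between two points means beyond exactly one of them. *)
Lemma separates_addb x y z w : uniq [:: x; y; z; w] ->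
  separates x y z w = (x < z) (+) (y < z) (+) ((x < w) (+) (y < w)).
Proof.
move=> u; have B v : v != x -> v != y -> (minn x y < v < maxn x y) = (x < v) (+) (y < v) by lia.
by move: u; rewrite /= !inE /separates => u; rewrite !B //; lia.
Qed.

(** The sum modulo 2 of the three conditions is 1. *)
Lemma separates_some x y z w : uniq [:: x; y; z; w] ->
  [|| separates x y z w, separates x z y w | separates x w y z].
Proof.
move=> u; have u2 : uniq [:: x; z; y; w] by move: u; rewrite /= !inE; lia.
have u3 : uniq [:: x; w; y; z] by move: u; rewrite /= !inE; lia.
rewrite !separates_addb //.
have -> : (z < y) = ~~ (y < z) by move: u; rewrite /= !inE; lia.
have -> : (w < y) = ~~ (y < w) by move: u; rewrite /= !inE; lia.
have -> : (w < z) = ~~ (z < w) by move: u; rewrite /= !inE; lia.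
by case: (x < y); case: (x < z); case: (x < w); case: (y < z); case: (y < w); case: (z < w).
Qed.

End Chords.

Section Arrangements.
Lemma perm4 (T : eqType) (x y z w : T) :
  [/\ perm_eq [:: x; y; z; w] [:: x; z; y; w], perm_eq [:: x; y; z; w] [:: x; w; y; z],
      perm_eq [:: x; y; z; w] [:: y; z; x; w] & perm_eq [:: x; y; z; w] [:: y; w; x; z]
   /\ perm_eq [:: x; y; z; w] [:: z; w; x; y]].
Proof. by do !split; apply/permP => q /=; lia. Qed.

Definition same_pair (T : Type) (a b a' b' : T) := (a = a' /\ b = b') \/ (a = b' /\ b = a').

Lemma perm_pairs (T : eqType) (x y z w x' y' z' w' : T) :
    (same_pair x y x' y' /\ same_pair z w z' w') \/ (same_pair x y z' w' /\ same_pair z w x' y') ->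
  perm_eq [:: x; y; z; w] [:: x'; y'; z'; w'].
Proof.
by case=> -[[[-> ->]|[-> ->]] [[-> ->]|[-> ->]]]; apply/permP => q /=; lia.
Qed.

Lemma separatesCl x y z w : separates x y z w = separates y x z w.
Proof. by rewrite /separates minnC maxnC. Qed.

Lemma separatesCr x y z w : separates x y z w = separates x y w z.
Proof. by rewrite /separates addbC. Qed.

Lemma not_separates B a b r s : (B <= a)%N -> (B <= b)%N ->
    (r < B)%N || (a < r)%N && (b < r)%N -> (s < B)%N || (a < s)%N && (b < s)%N ->
  (separates a b r s = false) * (separates r s a b = false).
Proof. by rewrite /separates; split; lia. Qed.

Definition top_pair_nat (x y z w : nat) := [&& x < z, x < w, y < z & y < w]%N.

Lemma top_pair_some x y z w : uniq [:: x; y; z; w] ->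
  [|| top_pair_nat x y z w, top_pair_nat x z y w, top_pair_nat x w y z,
      top_pair_nat y z x w, top_pair_nat y w x z | top_pair_nat z w x y].
Proof.
rewrite /= !inE /top_pair_nat.
case: (ltngtP x y) => // xy; case: (ltngtP z w) => // zw;
  case: (ltngtP x z) => // xz; case: (ltngtP x w) => // xw;
  case: (ltngtP y z) => // yz; case: (ltngtP y w) => //= yw _; lia.
Qed.

Lemma sum4_perm (a b e f : nat) : (a + f + (b + e) = a + b + (e + f))%N.
Proof. by lia. Qed.

End Arrangements.

Section QuadricLeads.
Variables (K : fieldType) (d : nat) (n : 'I_d -> nat).
Variables (N : nat) (jy : yvar n -> 'I_N).
Hypothesis jy_inj : injective jy.
Implicit Types (a b x y z w : 'I_(codim n)) (t : yvar n).
Local Notation xi1 := (@entry d n 0).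
Local Notation xi2 := (@entry d n 1).
Local Notation L := (2 * key_bound n + 1)%N.
Local Notation chord := (chord L).

Variables (u h : 'I_N -> nat).
Hypothesis u_jy : forall t, u (jy t) = (wt (xi1 (end0 t)) + wt (xi1 (end1 t)))%N.
Hypothesis h_jy : forall t, h (jy t) = chord (pos (end0 t)) (pos (end1 t)).

Local Notation edge_mon := (edge_mon jy).
Local Notation quadric_mon := (quadric_mon jy).
Local Notation S := (@ordS (codim n)).

Lemma pos_bounds a : (0 < pos a < L)%N.
Proof. by rewrite /pos; have := ckey_lt a; case: (a \in _); lia. Qed.

Lemma mwt_edge_mon_u a b : a != b -> mwt u (edge_mon a b) = (wt (xi1 a) + wt (xi1 b))%N.
Proof. by move=> /edgeP[t _ tab]; rewrite (edge_mon_ends _ tab) mwtU u_jy; case: tab => -[-> ->]; lia. Qed.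

Lemma mwt_edge_mon_h a b : a != b -> mwt h (edge_mon a b) = chord (pos a) (pos b).
Proof.
by move=> /edgeP[t _ tab]; rewrite (edge_mon_ends _ tab) mwtU h_jy; case: tab => -[-> ->] //; rewrite chordC.
Qed.

Lemma uniq_pos x y z w : uniq [:: x; y; z; w] -> uniq [:: pos x; pos y; pos z; pos w].
Proof. by rewrite -(map_inj_uniq (@pos_inj d n)). Qed.

Lemma uniq4 (T : eqType) (x y z w : T) : uniq [:: x; y; z; w] ->
  [/\ x != y, x != z, x != w & [/\ y != z, y != w & z != w]].
Proof. by rewrite /= !inE !negb_or => /and4P[/and3P[-> -> ->] /andP[-> ->] -> _]. Qed.

(** The terms have equal weight [u], and the crossing pair of chords has the
    largest total weight [h]. *)
Lemma plucker_lead s x y z w :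
    uniq [:: x; y; z; w] -> separates (pos x) (pos y) (pos z) (pos w) ->
    plucker_at K jy s x y z w ->
  wt_lead u h (quadric_mon x y z w) (plucker_rel (fun t => 'X_(jy t) : {mpoly K[N]}) s).
Proof.
move=> un sep [_ [c1 [c2 [c3 [n1 _ _ ->]]]]].
have [xy xz xw [yz yw zw]] := uniq4 un.
have /andP[_ bx] := pos_bounds x; have /andP[_ by_] := pos_bounds y.
have /andP[_ bz] := pos_bounds z; have /andP[_ bw] := pos_bounds w.
have /andP[lt1 lt2] := chord_separates (uniq_pos un) sep bx by_ bz bw.
apply: wt_leadDl; first apply: wt_leadDl; first exact: wt_leadU.
  apply: wt_below_h; last by rewrite !mwtD !mwt_edge_mon_h.
  by rewrite !mwtD !mwt_edge_mon_u // addnACA.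
apply: wt_below_h; last by rewrite !mwtD !mwt_edge_mon_h.
by rewrite !mwtD !mwt_edge_mon_u // sum4_perm.
Qed.

Lemma wt_ordS a : a \in Gam n -> wt (xi1 (S a)) = (wt (xi1 a) + delta a)%N.
Proof. by move=> ga; rewrite entry_ordS // wt_xi2. Qed.

Lemma ordS_neq a b : a \in Gam n -> b \in Gam n -> a != b -> S a != S b.
Proof.
move=> ga gb; apply: contra => /eqP/(congr1 (@nat_of_ord _)); rewrite !ordS_Gam // => -[e].
exact/eqP/val_inj.
Qed.

Definition top_pair x y z w :=
  top_pair_nat (delta x) (delta y) (delta z) (delta w).

(** The weight [u] of a term is the same constant plus [delta] of the two shifted
    columns. *)
Lemma shifted_lead s x y z w :
    uniq [:: x; y; z; w] -> all (mem (Gam n)) [:: x; y; z; w] -> top_pair x y z w ->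
    shifted_at K jy s x y z w ->
  wt_lead u h (quadric_mon x y (S z) (S w)) (shifted_rel (fun t => 'X_(jy t) : {mpoly K[N]}) s).
Proof.
move=> un /= /and5P[gx gy gz gw _] /and4P[xz' xw' yz' yw'].
move=> [_ [c1 [c2 [c3 [c4 [c5 [c6 [n1 [_ ->]]]]]]]]].
have [xy xz xw [yz yw zw]] := uniq4 un.
have U a b a' b' : a \in Gam n -> b \in Gam n -> a' \in Gam n -> b' \in Gam n ->
    a != b -> a' != b' -> mwt u (quadric_mon a b (S a') (S b')) =
    (wt (xi1 a) + wt (xi1 b) + (wt (xi1 a') + delta a' + (wt (xi1 b') + delta b')))%N.
  by move=> ga gb ga' gb' ab ab'; rewrite mwtD !mwt_edge_mon_u ?ordS_neq // !wt_ordS.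
do 5!(apply: wt_leadDl; last by apply: wt_below_u; rewrite !U //;
  clear -xz' xw' yz' yw'; move: (wt (xi1 x)) (wt (xi1 y)) (wt (xi1 z)) (wt (xi1 w)); lia).
exact: wt_leadU.
Qed.

(** The existential listing of the columns allows the comparison of leading
    monomials without knowing which columns cross or are shifted. *)
Definition quadric_shape (k : fiber_index n) (l : 'X_{1..N}) : Prop :=
  match k with
  | inl s => exists x y z w, [/\ perm_eq (val s) [:: x; y; z; w],
      separates (pos x) (pos y) (pos z) (pos w) & l = quadric_mon x y z w]
  | inr s => exists x y z w, [/\ perm_eq (val s) [:: x; y; z; w],
      top_pair x y z w & l = quadric_mon x y (S z) (S w)]
  end.

Lemma val_tnth4 (T : Type) (s : 4.-tuple T) : s = [:: tnth s 0; tnth s 1; tnth s 2; tnth s 3] :> seq T.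
Proof. by case: s => -[|x [|y [|z [|w [|? ?]]]]] //= sz; rewrite !(tnth_nth x). Qed.

Lemma incr_perm4 (G : {set 'I_(codim n)}) (s : incr G 4) : exists x y z w,
  [/\ perm_eq (val s) [:: x; y; z; w], uniq [:: x; y; z; w] & all (mem G) [:: x; y; z; w]].
Proof.
have e := val_tnth4 (val s).
exists (tnth (val s) 0), (tnth (val s) 1), (tnth (val s) 2), (tnth (val s) 3).
by rewrite -e incr_uniq perm_refl; split=> //; apply/allP => x; apply: incr_in.
Qed.

Lemma quadric_lead k : exists2 l, wt_lead u h l (quadric_rel (fun t => 'X_(jy t) : {mpoly K[N]}) k) &
  quadric_shape k l.
Proof.
case: k => s; have [x [y [z [w [p un inG]]]]] := incr_perm4 s.
  have H x' y' z' w' : separates (pos x') (pos y') (pos z') (pos w') ->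
     perm_eq [:: x; y; z; w] [:: x'; y'; z'; w'] ->
     exists2 l, wt_lead u h l (plucker_rel (fun t => 'X_(jy t) : {mpoly K[N]}) s) & quadric_shape (inl s) l.
    move=> sep p'; have un' : uniq [:: x'; y'; z'; w'] by rewrite -(perm_uniq p').
    have [s' s'at] := plucker_index K jy un'.
    have ss' : s' = s by apply: incr_inj; rewrite (perm_trans s'at.1) // perm_sym (perm_trans p).
    move: s'at; rewrite ss' => sat; exists (quadric_mon x' y' z' w'); first exact: plucker_lead.
    by exists x', y', z', w'; split=> //; apply: perm_trans p'.
  have [p1 p2 _ _] := perm4 x y z w.
  by have /or3P[sep|sep|sep] := separates_some (uniq_pos un); apply: (H _ _ _ _ sep).
have H x' y' z' w' : top_pair x' y' z' w' -> perm_eq [:: x; y; z; w] [:: x'; y'; z'; w'] ->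
     exists2 l, wt_lead u h l (shifted_rel (fun t => 'X_(jy t) : {mpoly K[N]}) s) & quadric_shape (inr s) l.
  move=> tp p'; have un' : uniq [:: x'; y'; z'; w'] by rewrite -(perm_uniq p').
  have inG' : all (mem (Gam n)) [:: x'; y'; z'; w'] by rewrite -(perm_all _ p').
  have [s' s'at] := shifted_index K jy un' inG'.
  have ss' : s' = s by apply: incr_inj; rewrite (perm_trans s'at.1) // perm_sym (perm_trans p).
  move: s'at; rewrite ss' => sat; exists (quadric_mon x' y' (S z') (S w')); first exact: shifted_lead.
  by exists x', y', z', w'; split=> //; apply: perm_trans p'.
have ud : uniq [:: delta x; delta y; delta z; delta w] by rewrite -(map_inj_uniq (@delta_inj d n)) in un.
have [p1 p2 p3 [p4 p5]] := perm4 x y z w.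
by case/or4P: (top_pair_some ud) => [tp|tp|tp|/or3P[tp|tp|tp]]; apply: (H _ _ _ _ tp).
Qed.

Lemma ends_same t a b a' b' : ends t a b -> ends t a' b' -> same_pair a b a' b'.
Proof. by case=> -[<- <-]; case=> -[<- <-]; [left|right|right|left]. Qed.

Lemma edge_mon_inj a b a' b' : a != b -> a' != b' -> edge_mon a b = edge_mon a' b' -> same_pair a b a' b'.
Proof.
move=> /edgeP[t _ tab] /edgeP[t' _ tab'].
rewrite (edge_mon_ends _ tab) (edge_mon_ends _ tab') => /eqP; rewrite eq_mnm1 => /eqP/jy_inj e.
by apply: (ends_same tab); rewrite e.
Qed.

Lemma quadric_mon_inj a b x y a' b' x' y' : a != b -> x != y -> a' != b' -> x' != y' ->
    quadric_mon a b x y = quadric_mon a' b' x' y' ->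
  (same_pair a b a' b' /\ same_pair x y x' y') \/ (same_pair a b x' y' /\ same_pair x y a' b').
Proof.
move=> ab xy ab' xy'; have E v w : v != w -> exists i, edge_mon v w = U_(i)%MM.
  by move=> /edgeP[t _ tvw]; exists (jy t); apply: edge_mon_ends.
have [i ei] := E _ _ ab; have [j ej] := E _ _ xy; have [k ek] := E _ _ ab'; have [l el] := E _ _ xy'.
rewrite /quadric_mon ei ej ek el => /mnmU2_inj[[ik jl]|[il jk]].
  by left; split; apply: edge_mon_inj => //; rewrite ?ei ?ek ?ej ?el ?ik ?jl.
by right; split; apply: edge_mon_inj => //; rewrite ?ei ?ek ?ej ?el ?il ?jk.
Qed.

Lemma Gam_facts a : a \in Gam n -> [/\ delta a = ckey a, pos a = (key_bound n + ckey a)%N,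
   ckey (S a) = (ckey a + d)%N & (0 < d)%N].
Proof.
move=> ga; rewrite /delta /pos ga addn0 /ckey entry_ordS // key_entry1; split=> //.
by have := ltn_ord (block a); lia.
Qed.

Lemma pos_Gam a : a \in Gam n -> (key_bound n <= pos a)%N.
Proof. by move=> ga; have [_ -> _ _] := Gam_facts ga; apply: leq_addr. Qed.

(** The successor of [a] is the last column of its block, to the left of
    [key_bound], or it lies to the right of [a], hence of [b] and [c]. *)
Lemma pos_ordS a b c : a \in Gam n -> b \in Gam n -> c \in Gam n ->
    (delta b < delta a)%N -> (delta c < delta a)%N ->
  (pos (S a) < key_bound n)%N || (pos b < pos (S a))%N && (pos c < pos (S a))%N.
Proof.
move=> ga gb gc; have [-> _ ea d0] := Gam_facts ga.
have [-> pb _ _] := Gam_facts gb; have [-> pc _ _] := Gam_facts gc => lt lt'.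
have := ckey_lt (S a); rewrite pb pc /pos ea; case: (S a \in _); lia.
Qed.

Lemma quadric_shape_uniq (G : {set 'I_(codim n)}) (s : incr G 4) x y z w :
  perm_eq (val s) [:: x; y; z; w] -> uniq [:: x; y; z; w].
Proof. by move=> p; rewrite -(perm_uniq p) incr_uniq. Qed.

Lemma quadric_shape_in (G : {set 'I_(codim n)}) (s : incr G 4) x y z w :
  perm_eq (val s) [:: x; y; z; w] -> all (mem G) [:: x; y; z; w].
Proof. by move=> p; rewrite -(perm_all _ p); apply/allP => v; apply: incr_in. Qed.

(** By [pos_ordS] the two chords of a shifted leading monomial do not cross. *)
Lemma plucker_shifted_shape s s' l :
  quadric_shape (inl s) l -> quadric_shape (inr s') l -> False.
Proof.
move=> [x [y [z [w [p sep ->]]]]] [x' [y' [z' [w' [p' tp e]]]]].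
have [xy _ _ [_ _ zw]] := uniq4 (quadric_shape_uniq p).
have [xy' _ _ [_ _ zw']] := uniq4 (quadric_shape_uniq p').
have /and5P[gx gy gz gw _] := quadric_shape_in p'.
have /and4P[t1 t2 t3 t4] := tp.
have ns := not_separates (pos_Gam gx) (pos_Gam gy) (pos_ordS gz gx gy t1 t3) (pos_ordS gw gx gy t2 t4).
have [[s1 s2]|[s1 s2]] := quadric_mon_inj xy zw xy' (ordS_neq gz gw zw') e;
  by case: s1 sep => -[-> ->]; case: s2 => -[-> ->];
    rewrite 1?[separates (pos y') _ _ _]separatesCl 1?[separates (pos (S w')) _ _ _]separatesCl
      1?[separates _ _ (pos y') _]separatesCr 1?[separates _ _ (pos (S w')) _]separatesCr ns.
Qed.

(** In a shifted leading monomial the shifted columns have larger [delta] than the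
    other ones, so the roles of the two pairs cannot be exchanged. *)
Lemma shifted_pairs_swap x y z w x' y' z' w' :
    all (mem (Gam n)) [:: x; y; z; w] -> all (mem (Gam n)) [:: x'; y'; z'; w'] ->
    top_pair x y z w -> top_pair x' y' z' w' ->
  same_pair x y (S z') (S w') -> same_pair (S z) (S w) x' y' -> False.
Proof.
move=> /and5P[gx gy gz gw _] /and5P[gx' gy' gz' gw' _].
have [dx _ _ d0] := Gam_facts gx; have [dy _ _ _] := Gam_facts gy.
have [dz _ kz _] := Gam_facts gz; have [dw _ kw _] := Gam_facts gw.
have [dx' _ _ _] := Gam_facts gx'; have [dy' _ _ _] := Gam_facts gy'.
have [dz' _ kz' _] := Gam_facts gz'; have [dw' _ kw' _] := Gam_facts gw'.
rewrite /top_pair /top_pair_nat dx dy dz dw dx' dy' dz' dw'.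
have absurd (p q p' q' : nat) : (p < q -> p' < q' -> p = q' + d -> q + d = p' -> False)%N by lia.
move=> /and4P[xz _ _ _] /and4P[xz' xw' yz' yw'].
case=> -[/(congr1 (@ckey d n)) + _] [] [/(congr1 (@ckey d n)) + _]; rewrite ?kz' ?kw' kz => e1 e2.
- exact: absurd xz xz' e1 e2.
- exact: absurd xz yz' e1 e2.
- exact: absurd xz xw' e1 e2.
- exact: absurd xz yw' e1 e2.
Qed.

Lemma quadric_shape_inj k k' l : quadric_shape k l -> quadric_shape k' l -> k = k'.
Proof.
case: k => s; case: k' => s'.
- move=> [x [y [z [w [p _ ->]]]]] [x' [y' [z' [w' [p' _ e]]]]].
  have [xy _ _ [_ _ zw]] := uniq4 (quadric_shape_uniq p).
  have [xy' _ _ [_ _ zw']] := uniq4 (quadric_shape_uniq p').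
  congr inl; apply: incr_inj; rewrite (perm_trans p) // perm_sym (perm_trans p') // perm_sym.
  exact/perm_pairs/quadric_mon_inj.
- by move=> h1 h2; case: (plucker_shifted_shape h1 h2).
- by move=> h1 h2; case: (plucker_shifted_shape h2 h1).
move=> [x [y [z [w [p tp ->]]]]] [x' [y' [z' [w' [p' tp' e]]]]].
have [xy _ _ [_ _ zw]] := uniq4 (quadric_shape_uniq p).
have [xy' _ _ [_ _ zw']] := uniq4 (quadric_shape_uniq p').
have inG := quadric_shape_in p; have inG' := quadric_shape_in p'.
have /and5P[gx gy gz gw _] := inG; have /and5P[gx' gy' gz' gw' _] := inG'.
have Sinj a b : a \in Gam n -> b \in Gam n -> S a = S b -> a = b.
  by move=> ga gb; have [//|ne] := eqVneq a b; have := ordS_neq ga gb ne; move=> /eqP.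
congr inr; apply: incr_inj; rewrite (perm_trans p) // perm_sym (perm_trans p') // perm_sym.
have [[s1 s2]|[s1 s2]] := quadric_mon_inj xy (ordS_neq gz gw zw) xy' (ordS_neq gz' gw' zw') e; last first.
  by case: (shifted_pairs_swap inG inG' tp tp' s1 s2).
apply: perm_pairs; left; split=> //.
by case: s2 => -[/Sinj-> // /Sinj-> //]; [left|right].
Qed.
End QuadricLeads.

Section RelationLeads.
Variables (K : fieldType) (d : nat) (n : 'I_d -> nat).
Variables (N : nat) (jy : yvar n -> 'I_N).
Hypothesis jy_inj : injective jy.
Implicit Types (a b c x y z w : 'I_(codim n)) (t : yvar n).
Local Notation xi1 := (@entry d n 0).
Local Notation xi2 := (@entry d n 1).
Local Notation L := (2 * key_bound n + 1)%N.
Local Notation chord := (chord L).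
Variables (u h : 'I_N -> nat).
Hypothesis u_jy : forall t, u (jy t) = (wt (xi1 (end0 t)) + wt (xi1 (end1 t)))%N.
Hypothesis h_jy : forall t, h (jy t) = chord (pos (end0 t)) (pos (end1 t)).
Local Notation edge_mon := (edge_mon jy).
Local Notation quadric_mon := (quadric_mon jy).
Local Notation Y := (fun t => 'X_(jy t) : {mpoly K[N]}).

Lemma crosses_separates a b c c' : crosses (@pos d n) a b c c' ->
  uniq [:: a; b; c; c'] /\ separates (pos a) (pos b) (pos c) (pos c').
Proof.
rewrite /crosses => /and4P[bc ca cb bc'].
have bb : between (@pos d n) c a b = (minn (pos a) (pos b) < pos c < maxn (pos a) (pos b))%N.
  by rewrite /between; lia.
have bb' : between (@pos d n) c' a b = (minn (pos a) (pos b) < pos c' < maxn (pos a) (pos b))%N.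
  by rewrite /between; lia.
have neq (e f : 'I_(codim n)) : pos e <> pos f -> (e == f) = false by move=> ne; apply/eqP => ef; apply: ne; rewrite ef.
split; last by rewrite /separates -bb -bb' bc (negbTE bc').
rewrite /= !inE (neq a b) ?(neq a c) ?(neq b c) ?(neq c c') /=; try by move: bc bc'; rewrite bb bb'; lia.
by rewrite ![_ == c']eq_sym (negbTE ca) (negbTE cb).
Qed.

(** Each of the four conditions of [admissible] forbids the leading monomial of a
    relation; here it is the one of a Pluecker relation. *)
Lemma crossing_lead t t' a b :
    crosses (@pos d n) (end0 t) (end1 t) a b -> ends t' a b ->
  exists k, wt_lead u h (U_(jy t) + U_(jy t'))%MM (quadric_rel Y k).
Proof.
move=> /crosses_separates[un sep] tab; have [s sat] := plucker_index K jy un.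
exists (inl s); have := plucker_lead u_jy h_jy un sep sat.
by rewrite (quadric_mon_ends jy (ends_refl t) tab).
Qed.

Lemma shifted_edges_lead t t' c c' :
    end0 t \in Gam n -> end1 t \in Gam n -> xi1 (end0 t') = xi2 c -> xi1 (end1 t') = xi2 c' ->
    (max_delta t < delta c)%N -> (max_delta t < delta c')%N ->
  (exists k, wt_lead u h (U_(jy t) + U_(jy t'))%MM (quadric_rel Y k)) /\ t != t'.
Proof.
move=> g0 g1 e e'; rewrite /max_delta !gtn_max => /andP[l0 l1] /andP[l0' l1'].
have gc : c \in Gam n by apply: contraT => /(@entry_last d n c (end0 t')); rewrite e.
have gc' : c' \in Gam n by apply: contraT => /(@entry_last d n c' (end1 t')); rewrite e'.
have Sc : ordS c = end0 t' by apply: (@entry_inj d n _ _ 0 isT); rewrite entry_ordS.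
have Sc' : ordS c' = end1 t' by apply: (@entry_inj d n _ _ 0 isT); rewrite entry_ordS.
have tt := end_lt t; have tt' := end_lt t'.
have neq a b : (delta a < delta b)%N -> (a == b) = false by move=> lt; apply/eqP => ab; rewrite ab ltnn in lt.
have un : uniq [:: end0 t; end1 t; c; c'].
  have ab : (end0 t == end1 t) = false by apply/eqP => f; move: tt; rewrite f ltnn.
  have cc : (c == c') = false by apply/eqP => f; move: tt'; rewrite -Sc -Sc' f ltnn.
  by rewrite !cons_uniq !in_cons !in_nil ab cc !neq.
have inG : all (mem (Gam n)) [:: end0 t; end1 t; c; c'] by rewrite /= g0 g1 gc gc'.
have [s sat] := shifted_index K jy un inG.
split.
  exists (inr s); have tp : top_pair (end0 t) (end1 t) c c' by rewrite /top_pair /top_pair_nat l0 l0' l1 l1'.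
  have := shifted_lead h u_jy un inG tp sat.
  by rewrite Sc Sc' (quadric_mon_ends jy (ends_refl t) (ends_refl t')).
apply/eqP => f; have [dc _ kc d0] := Gam_facts gc; have [d1 _ _ _] := Gam_facts g0.
by move: l0 kc; rewrite Sc -f dc d1; lia.
Qed.

Lemma mdeg_edge_mon a b : a != b -> mdeg (edge_mon a b) = 1%N.
Proof. by move=> /edgeP[t _ tab]; rewrite (edge_mon_ends jy tab) mdeg1. Qed.

Lemma mdeg_quadric_mon a b x y : a != b -> x != y -> mdeg (quadric_mon a b x y) = 2%N.
Proof. by move=> ab xy; rewrite mdegD !mdeg_edge_mon. Qed.

Lemma msuppZX (c : K) (mu m : 'X_{1..N}) : m \in msupp (c *: 'X_[mu] : {mpoly K[N]}) -> m = mu.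
Proof. by move=> /msuppZ_le; rewrite msuppX inE => /eqP. Qed.

Lemma quadric_homog k m : m \in msupp (quadric_rel Y k) -> mdeg m = 2%N.
Proof.
have homD (p q : {mpoly K[N]}) : (forall m', m' \in msupp p -> mdeg m' = 2%N) ->
    (forall m', m' \in msupp q -> mdeg m' = 2%N) -> forall m', m' \in msupp (p + q) -> mdeg m' = 2%N.
  by move=> hp hq m' /msuppD_le; rewrite mem_cat => /orP[/hp|/hq].
have homX (c : K) mu : mdeg mu = 2%N -> forall m', m' \in msupp (c *: 'X_[mu] : {mpoly K[N]}) -> mdeg m' = 2%N.
  by move=> h2 m' /msuppZX ->.
move: m; case: k => s /=; have [x [y [z [w [p un inG]]]]] := incr_perm4 s;
  have [xy xz xw [yz yw zw]] := uniq4 un.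
  have [s' [p' [c1 [c2 [c3 [_ _ _ e]]]]]] := plucker_index K jy un.
  have <- : s' = s by apply: incr_inj; rewrite (perm_trans p') // perm_sym.
  by rewrite e; do 2!(apply: (homD); last by apply: (homX); apply: mdeg_quadric_mon); apply: (homX); apply: mdeg_quadric_mon.
have [s' [p' [c1 [c2 [c3 [c4 [c5 [c6 [_ [_ e]]]]]]]]]] := shifted_index K jy un inG.
have <- : s' = s by apply: incr_inj; rewrite (perm_trans p') // perm_sym.
move: inG => /and5P[gx gy gz gw _].
rewrite e; do 5!(apply: (homD); last by apply: (homX); apply: mdeg_quadric_mon; rewrite ?ordS_neq).
by apply: (homX); apply: mdeg_quadric_mon; rewrite ?ordS_neq.
Qed.

Section Linear.
Variable jx : xvar n -> 'I_N.
Hypothesis jx_inj : injective jx.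
Hypothesis jxy : forall v t, jx v <> jy t.
Hypothesis u_jx : forall v, u (jx v) = wt v.
Hypothesis h_jx : forall a, h (jx (xi1 a)) = chord 0 (pos a).
Local Notation X := (fun v => 'X_(jx v) : {mpoly K[N]}).

Definition linear_mon v a b := (U_(jx v) + edge_mon a b)%MM.

Lemma linear_mon_sym v a b : linear_mon v a b = linear_mon v b a.
Proof. by rewrite /linear_mon edge_mon_sym. Qed.

Definition linear_at (s : incr [set: 'I_(codim n)] 3) x y z : Prop :=
  perm_eq (val s) [:: x; y; z] /\ forall r : 'I_2,
  exists c1 c2 c3 : K, [/\ c1 != 0, c2 != 0, c3 != 0 & linear_rel X Y r s =
    c1 *: 'X_[linear_mon (entry r x) y z] + c2 *: 'X_[linear_mon (entry r y) x z] + c3 *: 'X_[linear_mon (entry r z) x y]].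

Lemma linear_index x y z : uniq [:: x; y; z] -> exists s, linear_at s x y z.
Proof.
move: x y z; apply: sort3 => [x y z|x y z|x y z xyz].
- move=> [s [p e]]; exists s; split; first exact: perm_swap12.
  move=> r; have [c1 [c2 [c3 [n1 n2 n3 er]]]] := e r.
  by exists c2, c1, c3; split=> //; rewrite er (linear_mon_sym _ y x) [c2 *: _ + _]addrC.
- move=> [s [p e]]; exists s; split; first exact: perm_swap23.
  move=> r; have [c1 [c2 [c3 [n1 n2 n3 er]]]] := e r.
  by exists c1, c3, c2; split=> //; rewrite er (linear_mon_sym _ z y) addrAC.
have [|s sE] := @incr_mk3 _ [set: 'I_(codim n)] x y z xyz; first by rewrite /= !inE.
exists s; split; first by rewrite sE.
move=> r; exists 1, (-1), 1; rewrite oppr_eq0 oner_neq0; split=> //.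
rewrite /linear_rel sE.
have [-> -> ->] : [/\ tnth [tuple x; y; z] 0 = x, tnth [tuple x; y; z] 1 = y &
  tnth [tuple x; y; z] 2 = z] by [].
by rewrite !scroll_mxE !ycoord_edge_mon -?mpolyXD ?scale1r ?scaleN1r //; lia.
Qed.

(** For the first row, the chord from 0 to [x] crosses the one from [y] to [z]. *)
Definition linear_top (r : 'I_2) x y z : bool :=
  if r == 0 then separates 0 (pos x) (pos y) (pos z) else (delta y < delta x)%N && (delta z < delta x)%N.

Lemma uniq3 (T : eqType) (x y z : T) : uniq [:: x; y; z] -> [/\ x != y, x != z & y != z].
Proof. by rewrite /= !inE !negb_or => /and3P[/andP[-> ->] -> _]. Qed.

(** A first-row relation is homogeneous for [u], and [h] selects the crossing pair
    of chords; in a second-row relation the terms differ in weight [u] by [delta]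
    of the column of the second-row factor. *)
Lemma linear_lead s r x y z : uniq [:: x; y; z] -> linear_top r x y z -> linear_at s x y z ->
  wt_lead u h (linear_mon (entry r x) y z) (linear_rel X Y r s).
Proof.
move=> un top [_ /(_ r) [c1 [c2 [c3 [n1 _ _ ->]]]]]; have [xy xz yz] := uniq3 un.
have r01 : r = 0 \/ r = 1 by case: r {top} => -[|[|]] // lt; [left|right]; apply: val_inj.
case: r01 top => -> /=; rewrite /linear_top /= => top.
  have un4 : uniq [:: 0%N; pos x; pos y; pos z].
    have := un; rewrite -(map_inj_uniq (@pos_inj d n)) /= => ->; rewrite andbT !inE.
    by have := pos_bounds x; have := pos_bounds y; have := pos_bounds z; lia.
  have /andP[_ bx] := pos_bounds x; have /andP[_ by_] := pos_bounds y; have /andP[_ bz] := pos_bounds z.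
  have /andP[lt1 lt2] := chord_separates un4 top (leq_ltn_trans (leq0n _) bx) bx by_ bz.
  apply: wt_leadDl; first apply: wt_leadDl; first exact: wt_leadU.
    apply: wt_below_h; rewrite !mwtD !mwtU ?(mwt_edge_mon_u u_jy) ?(mwt_edge_mon_h h_jy) ?u_jx ?h_jx //.
    by rewrite addnCA.
  apply: wt_below_h; rewrite !mwtD !mwtU ?(mwt_edge_mon_u u_jy) ?(mwt_edge_mon_h h_jy) ?u_jx ?h_jx //.
  by rewrite addnC -!addnA; congr (_ + _)%N; rewrite addnC.
have /andP[lt1 lt2] := top.
have W v a b : a != b -> mwt u (linear_mon (xi2 v) a b) = (wt (xi1 v) + wt (xi1 a) + wt (xi1 b) + delta v)%N.
  by move=> ab; rewrite mwtD mwtU (mwt_edge_mon_u u_jy) // u_jx wt_xi2 addnAC addnA.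
apply: wt_leadDl; first apply: wt_leadDl; first exact: wt_leadU.
  apply: wt_below_u; rewrite !W //; clear -lt1; move: (wt (xi1 x)) (wt (xi1 y)) (wt (xi1 z)); lia.
apply: wt_below_u; rewrite !W //; clear -lt2; move: (wt (xi1 x)) (wt (xi1 y)) (wt (xi1 z)); lia.
Qed.

Definition linear_shape (k : 'I_2 * incr [set: 'I_(codim n)] 3) (l : 'X_{1..N}) : Prop :=
  exists x y z, [/\ perm_eq (val k.2) [:: x; y; z], linear_top k.1 x y z & l = linear_mon (entry k.1 x) y z].

Lemma perm3 (T : eqType) (x y z : T) :
  perm_eq [:: x; y; z] [:: y; x; z] /\ perm_eq [:: x; y; z] [:: z; x; y].
Proof. by split; apply/permP => q /=; lia. Qed.

Lemma not_separates0 k p r s : (0 < r)%N -> (0 < s)%N -> (k <= r)%N -> (k <= s)%N ->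
  (p < k)%N || (r < p)%N && (s < p)%N -> separates 0 p r s = false.
Proof. by rewrite /separates; lia. Qed.

Lemma linear_lead_ex k : exists2 l, wt_lead u h l (linear_rel X Y k.1 k.2) & linear_shape k l.
Proof.
case: k => r s /=.
have e : val s = [:: tnth (val s) 0; tnth (val s) 1; tnth (val s) 2] :> seq _.
  by case: (val s) => -[|x [|y [|z [|? ?]]]] //= sz; rewrite !(tnth_nth x).
set x := tnth _ 0 in e; set y := tnth _ 1 in e; set z := tnth _ 2 in e.
have un : uniq [:: x; y; z] by rewrite -e incr_uniq.
have H x' y' z' : linear_top r x' y' z' -> perm_eq [:: x; y; z] [:: x'; y'; z'] ->
    exists2 l, wt_lead u h l (linear_rel X Y r s) & linear_shape (r, s) l.
  move=> top p; have un' : uniq [:: x'; y'; z'] by rewrite -(perm_uniq p).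
  have [s' s'at] := linear_index un'.
  have ss' : s' = s by apply: incr_inj; rewrite (perm_trans s'at.1) // perm_sym /= e.
  move: s'at; rewrite ss' => sat; exists (linear_mon (entry r x') y' z'); first exact: linear_lead.
  by exists x', y', z'; split; rewrite //= e.
have [p1 p2] := perm3 x y z.
suff : [|| linear_top r x y z, linear_top r y x z | linear_top r z x y].
  by case/or3P => top; apply: (H _ _ _ top).
rewrite /linear_top; case: (r == 0).
  apply: separates_some; have := un; rewrite -(map_inj_uniq (@pos_inj d n)) /= => ->; rewrite andbT !inE.
  by have := pos_bounds x; have := pos_bounds y; have := pos_bounds z; lia.
have : uniq [:: delta x; delta y; delta z] by rewrite -(map_inj_uniq (@delta_inj d n)) in un.
by rewrite /= !inE; lia.
Qed.

Lemma linear_mon_inj v a b v' a' b' : a != b -> a' != b' -> linear_mon v a b = linear_mon v' a' b' -> v = v' /\ same_pair a b a' b'.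
Proof.
move=> ab ab' e; have [t _ tab] := edgeP ab; have [t' _ tab'] := edgeP ab'.
move: (e); rewrite /linear_mon (edge_mon_ends jy tab) (edge_mon_ends jy tab') => /mnmU2_inj[[/jx_inj -> /jy_inj tt']|[/jxy//]].
by split=> //; rewrite tt' in tab; apply: ends_same tab tab'.
Qed.

(** Only a first-row and a second-row leading monomial could coincide: then
    [xi1 a = xi2 c] with [delta c] larger than at both ends of the edge.  The
    column [a] is the successor of [c], and by [pos_ordS] it is not under the edge. *)
Lemma linear_shape_inj k k' l : linear_shape k l -> linear_shape k' l -> k = k'.
Proof.
case: k => r s; case: k' => r' s'.
move=> [x [y [z [/= p top ->]]]] [x' [y' [z' [/= p' top' e]]]].
have un : uniq [:: x; y; z] by rewrite -(perm_uniq p) incr_uniq.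
have un' : uniq [:: x'; y'; z'] by rewrite -(perm_uniq p') incr_uniq.
have [xy xz yz] := uniq3 un; have [xy' xz' yz'] := uniq3 un'.
have [ev sp] := linear_mon_inj yz yz' e.
have mixed a b c a' b' c' : separates 0 (pos a) (pos b) (pos c) -> b != c ->
    (delta b' < delta a')%N -> (delta c' < delta a')%N -> xi1 a = xi2 a' -> same_pair b c b' c' -> False.
  move=> sep bc lb lc ea s1.
  have ga' : a' \in Gam n by apply: contraT => /(@entry_last d n a' a); rewrite ea.
  have Sa : ordS a' = a by apply: (@entry_inj d n _ _ 0 isT); rewrite entry_ordS.
  have [da _ ka d0] := Gam_facts ga'; have ha := ckey_lt a'.
  have g f : (delta f < delta a')%N -> f \in Gam n.
    by move=> lt; apply: contraLR lt => ge; rewrite -leqNgt da /delta ge mul1n (leq_trans (ltnW ha)) ?leq_addl.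
  have gb : b' \in Gam n := g _ lb; have gc : c' \in Gam n := g _ lc.
  have := pos_ordS ga' gb gc lb lc; rewrite Sa => ps.
  have pb := pos_Gam gb; have pc := pos_Gam gc.
  have B0 : (0 < key_bound n)%N by [].
  case: s1 sep => -[-> ->]; last rewrite separatesCr;
    by rewrite (not_separates0 (leq_trans B0 pb) (leq_trans B0 pc) pb pc ps).
have r01 q : q = 0 :> 'I_2 \/ q = 1 :> 'I_2 by case: q => -[|[|]] // lt; [left|right]; apply: val_inj.
have s_eq : r = r' -> (r, s) = (r', s').
  move=> rr; rewrite rr in ev *; congr (_, _); apply: incr_inj.
  rewrite (perm_trans p) // perm_sym (perm_trans p') // perm_sym.
  have r1 : (r' <= 1)%N by rewrite -ltnS ltn_ord.
  rewrite (entry_inj r1 ev); case: sp => -[-> ->] //.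
  by rewrite perm_cons (perm_catC [:: _] [:: _]).
case: (r01 r) => re; case: (r01 r') => r'e; subst r r'.
- exact: s_eq.
- by case/andP: top' => l1 l2; case: (mixed _ _ _ _ _ _ top yz l1 l2 ev sp).
- case/andP: top => l1 l2; case: (mixed _ _ _ _ _ _ top' yz' l1 l2 (esym ev)).
  by case: sp => -[-> ->]; [left|right].
- exact: s_eq.
Qed.

Lemma linear_quadric_shape k k' l : linear_shape k l -> quadric_shape jy k' l -> False.
Proof.
move=> [x [y [z [/= p _ ->]]]] q.
have un : uniq [:: x; y; z] by rewrite -(perm_uniq p) incr_uniq.
have [_ _ yz] := uniq3 un; have [t _ tyz] := edgeP yz.
have H a b x' y' : a != b -> x' != y' -> linear_mon (entry k.1 x) y z = quadric_mon a b x' y' -> False.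
  move=> /edgeP[t1 _ e1] /edgeP[t2 _ e2].
  by rewrite /linear_mon (edge_mon_ends jy tyz) (quadric_mon_ends jy e1 e2) => /mnmU2_inj[[/jxy]|[/jxy]].
case: k' q => s' [x' [y' [z' [w' [p' _ e]]]]].
  by have [xy _ _ [_ _ zw]] := uniq4 (quadric_shape_uniq p'); apply: H e.
have [xy _ _ [_ _ zw]] := uniq4 (quadric_shape_uniq p').
have /and5P[_ _ gz gw _] := quadric_shape_in p'.
by apply: H e => //; apply: ordS_neq.
Qed.

Lemma leg_lead t x : between (@pos d n) x (end0 t) (end1 t) ->
  exists k, wt_lead u h (U_(jx (xi1 x)) + U_(jy t))%MM (linear_rel X Y k.1 k.2).
Proof.
move=> b; have un : uniq [:: x; end0 t; end1 t].
  have neq (e f : 'I_(codim n)) : pos e <> pos f -> (e == f) = false.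
    by move=> ne; apply/eqP => ef; apply: ne; rewrite ef.
  by rewrite /= !inE !neq //; move: b; rewrite /between; lia.
have [s sat] := linear_index un.
exists (0, s); have top : linear_top 0 x (end0 t) (end1 t).
  have := pos_bounds (end0 t); have := pos_bounds (end1 t).
  by move: b; rewrite /linear_top /between /separates eqxx; clear; lia.
have := linear_lead un top sat; by rewrite /linear_mon (edge_mon_ends jy (ends_refl t)).
Qed.

Lemma second_row_lead t c : (max_delta t < delta c)%N ->
  exists k, wt_lead u h (U_(jx (xi2 c)) + U_(jy t))%MM (linear_rel X Y k.1 k.2).
Proof.
rewrite /max_delta gtn_max => /andP[l0 l1].
have un : uniq [:: c; end0 t; end1 t].
  have neq (e f : 'I_(codim n)) : delta e <> delta f -> (e == f) = false.
    by move=> ne; apply/eqP => ef; apply: ne; rewrite ef.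
  have := end_lt t; rewrite /= !inE andbT -[end0 t == _]val_eqE /= => lt.
  by rewrite !neq /=; lia.
have [s sat] := linear_index un.
exists (1, s); have top : linear_top 1 c (end0 t) (end1 t) by rewrite /linear_top /= l0 l1.
have := linear_lead un top sat; by rewrite /linear_mon (edge_mon_ends jy (ends_refl t)).
Qed.

Lemma linear_homog k m : m \in msupp (linear_rel X Y k.1 k.2) -> mdeg m = 2%N.
Proof.
case: k => r s /=.
have e : val s = [:: tnth (val s) 0; tnth (val s) 1; tnth (val s) 2] :> seq _.
  by case: (val s) => -[|x [|y [|z [|? ?]]]] //= sz; rewrite !(tnth_nth x).
set x := tnth _ 0 in e; set y := tnth _ 1 in e; set z := tnth _ 2 in e.
have un : uniq [:: x; y; z] by rewrite -e incr_uniq.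
have [xy xz yz] := uniq3 un; have [s' [p' /(_ r) [c1 [c2 [c3 [_ _ _ er]]]]]] := linear_index un.
have ss' : s' = s by apply: incr_inj; rewrite (perm_trans p') // perm_sym /= e.
have D v a b : a != b -> mdeg (linear_mon v a b) = 2%N by move=> ab; rewrite mdegD mdeg1 mdeg_edge_mon.
rewrite -ss' er => /msuppD_le; rewrite mem_cat => /orP[/msuppD_le|/msuppZX -> //]; last exact: D.
by rewrite mem_cat => /orP[/msuppZX ->|/msuppZX ->]; apply: D.
Qed.

End Linear.
End RelationLeads.

(** * The kernels contain the relations *)

Section Minors.
Variables (d : nat) (n : 'I_d -> nat).
Local Notation xi1 := (@entry d n 0).
Local Notation xi2 := (@entry d n 1).

Section Values.
Variables (A : comNzRingType) (x : xvar n -> A) (s : A) (y : yvar n -> A).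
Hypothesis yE : forall t,
  y t = s * (x (xi1 (end0 t)) * x (xi2 (end1 t)) - x (xi1 (end1 t)) * x (xi2 (end0 t))).

Lemma ycoord_minor (a b : 'I_(codim n)) : (a < b)%N ->
  ycoord y a b = s * (x (xi1 a) * x (xi2 b) - x (xi1 b) * x (xi2 a)).
Proof. by move=> lt; rewrite ycoordE //; have [t -> [<- <-]] := edge_lt lt; apply: yE. Qed.

Lemma incr_lt (G : {set 'I_(codim n)}) k (t : incr G k) (i j : 'I_k) :
  (i < j)%N -> (tnth (val t) i < tnth (val t) j)%N.
Proof.
move=> ij; have /andP[st _] := valP t; set a := tnth _ _.
have tr : transitive (fun a b : 'I_(codim n) => (a < b)%N) by move=> b c e; apply: ltn_trans.
rewrite /a !(tnth_nth a); apply: (sorted_ltn_nth tr a st) => //; by rewrite inE size_tuple.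
Qed.

Lemma linear_rel0 r t : linear_rel x y r t = 0.
Proof.
rewrite /linear_rel !scroll_mxE !ycoord_minor ?incr_lt //.
by case: r => -[|[|//]] lt /=; ring.
Qed.

Lemma plucker_rel0 t : plucker_rel y t = 0.
Proof. by rewrite /plucker_rel !ycoord_minor ?incr_lt //; ring. Qed.

Lemma shifted_rel0 t : shifted_rel y t = 0.
Proof.
have g i : tnth (val t) i \in Gam n by apply/incr_in/mem_tnth.
have lt (i j : 'I_4) : (i < j)%N -> (ordS (tnth (val t) i) < ordS (tnth (val t) j))%N.
  by move=> ij; rewrite !ordS_Gam // ltnS incr_lt.
rewrite /shifted_rel !ycoord_minor ?lt ?incr_lt // !entry_ordS //.
ring.
Qed.

Lemma quadric_rel0 k : quadric_rel y k = 0.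
Proof. by case: k => t; [apply: plucker_rel0 | apply: shifted_rel0]. Qed.
End Values.

Section Morphism.
Variables (A B : nzRingType) (f : {rmorphism A -> B}) (x : xvar n -> A) (y : yvar n -> A).

Lemma rmorph_ycoord (a b : 'I_(codim n)) : f (ycoord y a b) = ycoord (f \o y) a b.
Proof. by rewrite /ycoord; case: insub => [t|] //=; apply: rmorph0. Qed.

Lemma rmorph_linear_rel r t : f (linear_rel x y r t) = linear_rel (f \o x) (f \o y) r t.
Proof. by rewrite /linear_rel !scroll_mxE !(rmorphD, rmorphN, rmorphM) !rmorph_ycoord. Qed.

Lemma rmorph_quadric_rel k : f (quadric_rel y k) = quadric_rel (f \o y) k.
Proof.
by case: k => t; rewrite /= /plucker_rel /shifted_rel !(rmorphD, rmorphN, rmorphM) !rmorph_ycoord.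
Qed.
End Morphism.
End Minors.

HB.instance Definition _ (K : fieldType) (d : nat) (n : 'I_d -> nat) :=
  GRing.RMorphism.copy (@psi_rees K d n) (mmap _ _).
HB.instance Definition _ (K : fieldType) (d : nat) (n : 'I_d -> nat) :=
  GRing.RMorphism.copy (@psi_fiber K d n) (mmap _ _).

Section Kernels.
Variables (K : fieldType) (d : nat) (n : 'I_d -> nat).
Local Notation W := (xvar n + yvar n)%type.
Local Notation xi1 := (@entry d n 0).
Local Notation xi2 := (@entry d n 1).

Lemma psi_rees_mvar (w : W) :
  psi_rees (mvar K w) = match w with inl v => (mvar K v)%:P | inr t => minor2 K t *: 'X end.
Proof. by rewrite /psi_rees /mvar mmapX mmap1U enum_rankK. Qed.

Lemma psi_fiber_mvar (t : yvar n) : psi_fiber (mvar K t) = minor2 K t.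
Proof. by rewrite /psi_fiber /mvar mmapX mmap1U enum_rankK. Qed.

Lemma minor2_entry t : minor2 K t = mvar K (xi1 (end0 t)) * mvar K (xi2 (end1 t))
  - mvar K (xi1 (end1 t)) * mvar K (xi2 (end0 t)).
Proof. by rewrite /minor2 !scroll_mxE. Qed.

Lemma rees_gens_ker k : ker (@psi_rees K d n) (rees_gens K k).
Proof.
pose X (v : xvar n) := mvar K (inl v : W); pose Y (t : yvar n) := mvar K (inr t : W).
pose x v := psi_rees (X v); pose y t := psi_rees (Y t).
have yE t : y t = 'X * (x (xi1 (end0 t)) * x (xi2 (end1 t)) - x (xi1 (end1 t)) * x (xi2 (end0 t))).
  rewrite /x /y !psi_rees_mvar minor2_entry -mul_polyC mulrC; congr (_ * _).
  by rewrite !(rmorphB, rmorphM).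
have eL r t : psi_rees (linear_rel X Y r t) = linear_rel x y r t by exact: rmorph_linear_rel.
have eQ q : psi_rees (quadric_rel Y q) = quadric_rel y q by exact: rmorph_quadric_rel.
case: k => [[r t]|q]; first exact: etrans (eL r t) (linear_rel0 yE r t).
exact: etrans (eQ q) (quadric_rel0 yE q).
Qed.

Lemma fiber_gens_ker k : ker (@psi_fiber K d n) (fiber_gens K k).
Proof.
rewrite /ker /fiber_gens rmorph_quadric_rel.
apply: (@quadric_rel0 _ _ _ (@mvar K (xvar n)) 1) => t.
by rewrite /= psi_fiber_mvar minor2_entry mul1r.
Qed.

End Kernels.

Section StandardQuadrics.
Variables (K : fieldType) (d : nat) (n : 'I_d -> nat).
Variables (N : nat) (jy : yvar n -> 'I_N).
Hypothesis jy_inj : injective jy.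
Local Notation xi1 := (@entry d n 0).
Local Notation xi2 := (@entry d n 1).
Local Notation L := (2 * key_bound n + 1)%N.
Variables (u h : 'I_N -> nat).
Hypothesis u_jy : forall t, u (jy t) = (wt (xi1 (end0 t)) + wt (xi1 (end1 t)))%N.
Hypothesis h_jy : forall t, h (jy t) = chord L (pos (end0 t)) (pos (end1 t)).
Local Notation Y := (fun t => 'X_(jy t) : {mpoly K[N]}).
Variable m : 'X_{1..N}.
Hypothesis std : forall k mu, wt_lead u h mu (quadric_rel Y k) -> ~~ (mu <= m)%MM.

Lemma standard_no_crossing t t' : (0 < m (jy t) -> 0 < m (jy t') ->
  ~~ crosses (@pos d n) (end0 t) (end1 t) (end0 t') (end1 t') &&
  ~~ crosses (@pos d n) (end0 t) (end1 t) (end1 t') (end0 t'))%N.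
Proof.
move=> mt mt'.
have H a b : ends t' a b -> ~~ crosses (@pos d n) (end0 t) (end1 t) a b.
  move=> tab; apply/negP => cr; have [k /std/negP] := crossing_lead K u_jy h_jy cr tab.
  apply; apply: mnm_pair_le => //; rewrite (inj_eq jy_inj); apply/eqP => e.
  have [un _] := crosses_separates cr; move: un tab; rewrite e /= !inE => un.
  by case=> -[ea eb]; move: un; rewrite -ea -eb eqxx ?orbT.
by rewrite !H //; [right|left].
Qed.

Lemma standard_no_shift t t' c c' : (0 < m (jy t) -> 0 < m (jy t') ->
  end0 t \in Gam n -> end1 t \in Gam n -> xi1 (end0 t') = xi2 c -> xi1 (end1 t') = xi2 c' ->
  (delta c <= max_delta t) || (delta c' <= max_delta t))%N.
Proof.
move=> mt mt' g0 g1 e e'; apply: contraT; rewrite negb_or -!ltnNge => /andP[l l'].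
have [[k lead] tt] := shifted_edges_lead K h u_jy g0 g1 e e' l l'.
by case/negP: (std lead); apply: mnm_pair_le => //; rewrite (inj_eq jy_inj).
Qed.
End StandardQuadrics.

(** * The Rees ring *)

Section Main.
Variables (K : fieldType) (d : nat) (n : 'I_d -> nat).
Local Notation W := (xvar n + yvar n)%type.
Local Notation xi1 := (@entry d n 0).
Local Notation xi2 := (@entry d n 1).
Local Notation L := (2 * key_bound n + 1)%N.
Hypothesis col0 : 'I_(codim n).

(** The second-row variables that are not in the first row get 0; they occur only
    in relations in which [twt] decides. *)
Definition vwt (w : W) : nat :=
  match w with
  | inl v => if [pick a | xi1 a == v] is Some a then chord L 0 (pos a) else 0%N
  | inr t => chord L (pos (end0 t)) (pos (end1 t))
  end.

Section Rees.
Let jx (v : xvar n) : 'I_#|{: W}| := enum_rank (inl v : W).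
Let jy (t : yvar n) : 'I_#|{: W}| := enum_rank (inr t : W).
Let u := on_rvars (@twt d n).
Let h := on_rvars vwt.

Let jx_inj : injective jx. Proof. by move=> v v' /enum_rank_inj[]. Qed.
Let jy_inj : injective jy. Proof. by move=> t t' /enum_rank_inj[]. Qed.
Let jxy v t : jx v <> jy t. Proof. by move=> /enum_rank_inj. Qed.
Let u_jx v : u (jx v) = wt v. Proof. by rewrite /u /on_rvars enum_rankK. Qed.
Let u_jy t : u (jy t) = (wt (xi1 (end0 t)) + wt (xi1 (end1 t)))%N.
Proof. by rewrite /u /on_rvars enum_rankK. Qed.
Let h_jy t : h (jy t) = chord L (pos (end0 t)) (pos (end1 t)).
Proof. by rewrite /h /on_rvars enum_rankK. Qed.
Let h_jx a : h (jx (xi1 a)) = chord L 0 (pos a).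
Proof.
rewrite /h /on_rvars enum_rankK /vwt; case: pickP => [c /eqP /(@entry_inj d n c a 0 isT) -> //|/(_ a)].
by rewrite eqxx.
Qed.

Definition rees_shape (k : rees_index n) : 'X_{1..#|{: W}|} -> Prop :=
  match k with inl k => linear_shape jy jx k | inr q => quadric_shape jy q end.

Lemma rees_lead (k : rees_index n) : exists2 l, wt_lead u h l (rees_gens K k) & rees_shape k l.
Proof.
case: k => [[r s]|q]; last exact: (quadric_lead K u_jy h_jy q).
exact: (linear_lead_ex K u_jy h_jy u_jx h_jx (r, s)).
Qed.

Lemma rees_shape_inj k k' l : rees_shape k l -> rees_shape k' l -> k = k'.
Proof.
case: k => k; case: k' => k' /=.
- by move=> s1 s2; rewrite (linear_shape_inj jy_inj jx_inj jxy s1 s2).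
- by move=> s1 s2; case: (linear_quadric_shape jxy s1 s2).
- by move=> s1 s2; case: (linear_quadric_shape jxy s2 s1).
- by move=> s1 s2; rewrite (quadric_shape_inj jy_inj s1 s2).
Qed.

Lemma rees_homog (k : rees_index n) m : m \in msupp (rees_gens K k) -> mdeg m = 2%N.
Proof.
case: k => [[r s]|q]; last exact: (@quadric_homog K d n _ jy q m).
exact: (@linear_homog K d n _ jy jx (r, s) m).
Qed.

Lemma rees_standard_admissible (m : 'X_{1..#|{: W}|}) :
  (forall (k : rees_index n) mu, wt_lead u h mu (rees_gens K k) -> ~~ (mu <= m)%MM) -> admissible m.
Proof.
move=> std.
have stdq (k : fiber_index n) mu : wt_lead u h mu (quadric_rel (fun t => 'X_(jy t) : {mpoly K[_]}) k) -> ~~ (mu <= m)%MM.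
  exact: (std (inr k)).
have stdl k mu : wt_lead u h mu (linear_rel (fun v => 'X_(jx v) : {mpoly K[_]}) (fun t => 'X_(jy t)) k.1 k.2) ->
    ~~ (mu <= m)%MM.
  by case: k => r s; exact: (std (inl (r, s))).
have ne v t : jx v != jy t by apply/eqP/jxy.
split.
- exact: (standard_no_crossing jy_inj u_jy h_jy stdq).
- move=> t x mt mx; apply/negP => b; have [k /stdl/negP] := leg_lead K u_jy h_jy u_jx h_jx b.
  by apply; apply: mnm_pair_le.
- move=> t c mt mc; rewrite leqNgt; apply/negP => lt.
  have [k /stdl/negP] := second_row_lead K u_jy h_jy u_jx h_jx lt.
  by apply; apply: mnm_pair_le.
- exact: (standard_no_shift jy_inj u_jy stdq).
Qed.

Lemma rees_basis : minimally_generated_by (ker (@psi_rees K d n)) (@rees_gens K d n) /\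
  exists le, term_order le /\ groebner_basis le (ker (@psi_rees K d n)) (@rees_gens K d n).
Proof.
have [l lead shape] := fin_all_exists2 rees_lead.
apply: (kernel_basis lead _ rees_homog (@rees_gens_ker K d n)).
  by move=> k k' e; apply: (rees_shape_inj (shape k)); rewrite e.
move=> p pk std; apply: (admissible_independent col0 pk) => m mp.
apply: rees_standard_admissible => k mu mulead; rewrite (wt_lead_uniq mulead (lead k)).
exact: std.
Qed.
End Rees.

End Main.

(** * The special fiber ring *)

Section Fiber.
Variables (K : fieldType) (d : nat) (n : 'I_d -> nat).
Local Notation W := (xvar n + yvar n)%type.
Local Notation M := 'X_{1..#|{: yvar n}|}.
Local Notation xi1 := (@entry d n 0).
Local Notation xi2 := (@entry d n 1).
Local Notation L := (2 * key_bound n + 1)%N.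
Hypothesis col0 : 'I_(codim n).

(** The same monomial, seen in the larger polynomial ring. *)
Definition y_mon (m : M) : 'X_{1..#|{: W}|} :=
  [multinom if enum_val k is inr t then m (enum_rank t) else 0%N | k < #|{: W}|].

Lemma expo_y_monr m t : expo (y_mon m) (inr t) = m (enum_rank t).
Proof. by rewrite /expo mnmE enum_rankK. Qed.

Lemma expo_y_monl m v : expo (y_mon m) (inl v) = 0%N.
Proof. by rewrite /expo mnmE enum_rankK. Qed.

Definition y_part (mu : 'X_{1..#|{: W}|}) : M :=
  [multinom expo mu (inr (enum_val k)) | k < #|{: yvar n}|].

Lemma y_monK : cancel y_mon y_part.
Proof. by move=> m; apply/mnmP => k; rewrite mnmE expo_y_monr enum_valK. Qed.

Lemma mon_img_y_mon m :
  mon_img K (y_mon m) = \prod_(k < #|{: yvar n}|) minor2 K (enum_val k) ^+ m k.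
Proof.
rewrite /mon_img (reindex_onto (@enum_rank W) (@enum_val W xpredT)) /=; last by move=> k _; rewrite enum_valK.
rewrite (eq_bigl xpredT); last by move=> w; rewrite enum_rankK eqxx.
rewrite big_sumType /= big1 ?mul1r => [|v _]; last first.
  by rewrite -/(expo (y_mon m) (inl v)) expo_y_monl expr0.
rewrite [RHS](reindex_onto (@enum_rank (yvar n)) (@enum_val _ xpredT)) /=; last by move=> k _; rewrite enum_valK.
apply: eq_big => [t|t _]; first by rewrite enum_rankK eqxx.
by rewrite -/(expo (y_mon m) (inr t)) expo_y_monr !enum_rankK.
Qed.

Lemma psi_fiberE (p : polyY K n) : psi_fiber p = \sum_(m <- msupp p) p@_m *: mon_img K (y_mon m).
Proof.
by rewrite /psi_fiber /mmap; apply: eq_bigr => m _; rewrite mon_img_y_mon mul_mpolyC.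
Qed.

Lemma minor2_homog (t : yvar n) : minor2 K t \is 2.-homog.
Proof.
by rewrite minor2E; apply: rpredB; rewrite -[2%N]/(1 + 1)%N dhomogX /= mdegD !mdeg1.
Qed.

Lemma dhomogX_exp N (p : {mpoly K[N]}) k e : p \is k.-homog -> p ^+ e \is (k * e).-homog.
Proof.
move=> pk; elim: e => [|e IH]; first by rewrite muln0 expr0 dhomog1.
by rewrite exprS mulnS; apply: dhomogM.
Qed.

Lemma mon_img_homog (m : M) : mon_img K (y_mon m) \is (2 * ydeg (y_mon m)).-homog.
Proof.
have -> : ydeg (y_mon m) = (\sum_(k < #|{: yvar n}|) m k)%N.
  rewrite ydegE (reindex_onto (@enum_rank (yvar n)) (@enum_val _ xpredT)) /=; last by move=> k _; rewrite enum_valK.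
  by apply: eq_big => [t|t _]; rewrite ?enum_rankK ?eqxx ?expo_y_monr.
rewrite mon_img_y_mon; elim: (index_enum _) => [|k r IH]; first by rewrite !big_nil muln0 dhomog1.
by rewrite !big_cons mulnDr; apply: dhomogM => //; apply/dhomogX_exp/minor2_homog.
Qed.

(** The image of a monomial of degree [k] in the Y is homogeneous of degree
    [2 k]. *)
Lemma psi_fiber_component (p : polyY K n) k : psi_fiber p = 0 ->
  \sum_(m <- msupp p | ydeg (y_mon m) == k) p@_m *: mon_img K (y_mon m) = 0.
Proof.
rewrite psi_fiberE => p0; apply/mpolyP => mu; rewrite mcoeff0.
have zero m : mdeg mu != (2 * ydeg (y_mon m))%N -> (p@_m *: mon_img K (y_mon m))@_mu = 0.
  by move=> ne; rewrite mcoeffZ (dhomog_nemf_coeff (mon_img_homog m) ne) mulr0.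
rewrite raddf_sum /=; have [e|ne] := eqVneq (mdeg mu) (2 * k)%N; last first.
  by apply: big1 => m /eqP mk; apply: zero; rewrite mk.
move: p0 => /(congr1 (mcoeff mu)); rewrite mcoeff0 raddf_sum /=.
rewrite (bigID (fun m => ydeg (y_mon m) == k)) /= [X in _ + X]big1 ?addr0 // => m mk.
by apply: zero; rewrite e eqn_pmul2l // eq_sym.
Qed.

Lemma fiber_independent (p : polyY K n) :
  psi_fiber p = 0 -> (forall m, m \in msupp p -> admissible (y_mon m)) -> p = 0.
Proof.
move=> p0 adm; apply/mpolyP => m; rewrite mcoeff0.
have [mp|/memN_msupp_eq0 //] := boolP (m \in msupp p).
rewrite -[m in LHS]y_monK.
apply: (@admissible_free K d n col0 (ydeg (y_mon m))
  [seq y_mon m' | m' <- msupp p & ydeg (y_mon m') == ydeg (y_mon m)] (fun mu => p@_(y_part mu)) _ _ _ (y_mon m)).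
- by rewrite (map_inj_uniq (can_inj y_monK)) filter_uniq ?msupp_uniq.
- by move=> _ /mapP[m' + ->]; rewrite mem_filter => /andP[/eqP -> /adm].
- rewrite big_map big_filter -[RHS](psi_fiber_component (ydeg (y_mon m)) p0).
  by apply: eq_bigr => m' _; rewrite y_monK.
- by apply: map_f; rewrite mem_filter eqxx.
Qed.

Let jy (t : yvar n) : 'I_#|{: yvar n}| := enum_rank t.
Let u (k : 'I_#|{: yvar n}|) := twt (inr (enum_val k) : W).
Let h (k : 'I_#|{: yvar n}|) := vwt (inr (enum_val k) : W).
Let jy_inj : injective jy := @enum_rank_inj _.
Let u_jy t : u (jy t) = (wt (xi1 (end0 t)) + wt (xi1 (end1 t)))%N.
Proof. by rewrite /u enum_rankK. Qed.
Let h_jy t : h (jy t) = chord L (pos (end0 t)) (pos (end1 t)).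
Proof. by rewrite /h enum_rankK. Qed.

Lemma fiber_standard_admissible (m : M) :
  (forall (k : fiber_index n) mu, wt_lead u h mu (fiber_gens K k) -> ~~ (mu <= m)%MM) -> admissible (y_mon m).
Proof.
move=> std; split.
- by move=> t t'; rewrite !expo_y_monr; apply: (standard_no_crossing jy_inj u_jy h_jy std).
- by move=> t x _; rewrite expo_y_monl.
- by move=> t c _; rewrite expo_y_monl.
- by move=> t t' c c'; rewrite !expo_y_monr; apply: (standard_no_shift jy_inj u_jy std).
Qed.

Lemma fiber_basis : minimally_generated_by (ker (@psi_fiber K d n)) (@fiber_gens K d n) /\
  exists le, term_order le /\ groebner_basis le (ker (@psi_fiber K d n)) (@fiber_gens K d n).
Proof.
have [l lead shape] := fin_all_exists2 (quadric_lead K u_jy h_jy).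
apply: (kernel_basis lead _ (@quadric_homog K d n _ jy) (@fiber_gens_ker K d n)).
  by move=> k k' e; apply: (quadric_shape_inj jy_inj (shape k)); rewrite e.
move=> p pk std; apply: (fiber_independent pk) => m mp.
apply: fiber_standard_admissible => k mu mulead; rewrite (wt_lead_uniq mulead (lead k)).
exact: std.
Qed.
End Fiber.

Theorem mainTheorem1 (K : fieldType) (d : nat) (n : 'I_d -> nat)
    (d_gt0 : (0 < d)%N)
    (n_gt0 : forall i : 'I_d, (0 < n i)%N)
    (n_mono : forall i j : 'I_d, (i <= j)%N -> (n i <= n j)%N) :
  [/\ minimally_generated_by (ker (@psi_rees K d n)) (@rees_gens K d n),
      minimally_generated_by (ker (@psi_fiber K d n)) (@fiber_gens K d n),
      (exists le : rel (multinom #|{: xvar n + yvar n}|),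
         term_order le /\
         groebner_basis le (ker (@psi_rees K d n)) (@rees_gens K d n)) &
      (exists le : rel (multinom #|{: yvar n}|),
         term_order le /\
         groebner_basis le (ker (@psi_fiber K d n)) (@fiber_gens K d n))].
Proof.
have col0 : 'I_(codim n) := col (Ordinal (n_gt0 (Ordinal d_gt0))).
have [reesM reesG] := @rees_basis K d n col0.
have [fiberM fiberG] := @fiber_basis K d n col0.
by split.
Qed.
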